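(* Let $r,\sigma$ be nonzero real constants. For every $q\in\{1,2,3,4\}$, every $i\in\{1,\dots,6\}$ and every $n\in\{0,-2,-4,-6,\dots\}$, the elementary function solution $\Phi_{q,n}(t,S,C)=0$ of the Bachelier PDE $$ rS\,\frac{\partial C}{\partial S}+\frac12\sigma^2\frac{\partial^2 C}{\partial S^2}+\frac{\partial C}{\partial t}-rC=0 $$ is mapped by the one-parameter Lie group of point symmetries $G_i$ (with parameter $\varepsilon_i$) of this PDE to the one-parameter family (with parameter $\varepsilon_i$) of elementary function solutions $\Phi_{q,n}(G_i(t),G_i(S),G_i(C))=0$ of the same PDE. Thus one obtains in total twenty-four classes (one for each pair $(q,i)$) of one-parameter families of elementary function solutions of the Bachelier PDE, given by $$q=1:\quad G_i(C)-G_i(S)\,F\!\left(\tfrac n2,\tfrac32;-r\left(\tfrac{G_i(S)}{\sigma}\right)^2\right)e^{nrG_i(t)}=0,$$ $$q=2:\quad G_i(C)-F\!\left(\tfrac n2,\tfrac12;-r\left(\tfrac{G_i(S)}{\sigma}\right)^2\right)e^{(n+1)rG_i(t)}=0,$$ $$q=3:\quad G_i(C)-e^{-r\left(\frac{G_i(S)}{\sigma}\right)^2}G_i(S)\,F\!\left(\tfrac n2,\tfrac32;r\left(\tfrac{G_i(S)}{\sigma}\right)^2\right)e^{-(n-3)rG_i(t)}=0,$$ $$q=4:\quad G_i(C)-e^{-r\left(\frac{G_i(S)}{\sigma}\right)^2}F\!\left(\tfrac n2,\tfrac12;r\left(\tfrac{G_i(S)}{\sigma}\right)^2\right)e^{-(n-2)rG_i(t)}=0,$$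 each class containing denumerably infinitely many members, enumerated by $n=0,-2,-4,-6,\dots$. Each of these equations can be solved explicitly with respect to $C$.
   Context: An equation $\Phi(t,S,C)=0$ is called a solution of the PDE when it determines $C$ as a function of $(t,S)$ that satisfies the PDE. $F(e,q;u)=\sum_{k=0}^\infty\frac{(e)_k}{(q)_k}\frac{u^k}{k!}$, with $(w)_k=w(w+1)\cdots(w+k-1)$, is Kummer's confluent hypergeometric function of the first kind; for $e=-m$ with $m$ a non-negative integer it is a polynomial in $u$ of degree $m$. For $n\in\{0,-2,-4,\dots\}$ set $\Phi_{q,n}(t,S,C)=C-C_{q,n}(t,S)$, where $C_{1,n}(t,S)=S\,F\big(\tfrac n2,\tfrac32;-r(S/\sigma)^2\big)e^{nrt}$, $C_{2,n}(t,S)=F\big(\tfrac n2,\tfrac12;-r(S/\sigma)^2\big)e^{(n+1)rt}$, $C_{3,n}(t,S)=e^{-r(S/\sigma)^2}S\,F\big(\tfrac n2,\tfrac32;r(S/\sigma)^2\big)e^{-(n-3)rt}$, $C_{4,n}(t,S)=e^{-r(S/\sigma)^2}F\big(\tfrac n2,\tfrac12;r(S/\sigma)^2\big)e^{-(n-2)rt}$. The one-parameter groups of point symmetries $G_i:(t,S,C)\mapsto(G_i(t),G_i(S),G_i(C))$, with real parameters $\varepsilon_i$, are $G_1:(t+\varepsilon_1,\,S,\,C)$; $G_2:(t,\,S+\varepsilon_2e^{rt},\,C)$; $G_3:\Big(t,\,S+\varepsilon_3e^{-rt},\,e^{-\varepsilon_3re^{-rt}(\varepsilon_3e^{-rt}+2S)/\sigma^2}C\Big)$;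 $G_4:\left(\frac{\ln(e^{2rt}+\varepsilon_4)}{2r},\,\frac{e^{rt}S}{\sqrt{e^{2rt}+\varepsilon_4}},\,e^{-\frac{r\left(2\sigma^2t(e^{2rt}+\varepsilon_4)-\varepsilon_4S^2\right)}{\sigma^2(e^{2rt}+\varepsilon_4)}}(e^{2rt}+\varepsilon_4)C\right)$; $G_5:\left(-\frac{\ln(e^{-2rt}+\varepsilon_5)}{2r},\,\frac{e^{-rt}S}{\sqrt{e^{-2rt}+\varepsilon_5}},\,\frac{e^{-rt}C}{\sqrt{e^{-2rt}+\varepsilon_5}}\right)$; $G_6:(t,\,S,\,e^{\varepsilon_6}C)$. Here $G_4$ is considered where $e^{2rt}+\varepsilon_4>0$ and $G_5$ where $e^{-2rt}+\varepsilon_5>0$. The solution $\Phi_{q,n}=0$ is ''mapped by $G_i$ to'' $\Phi_{q,n}(G_i(t),G_i(S),G_i(C))=0$, i.e. $(G_i(t),G_i(S),G_i(C))$ is substituted for $(t,S,C)$. The family may be degenerate: for exceptional $(q,n,i)$ with $\Phi_{q,n}=0$ invariant under $G_i$, all its members coincide with the original solution. *)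

(* Defs.v *)
From Stdlib Require Import Reals ZArith List.
From Coquelicot Require Import Coquelicot.
Open Scope R_scope.

Fixpoint pochhammer (w : R) (k : nat) : R :=
  match k with
  | O => 1
  | Datatypes.S j => pochhammer w j * (w + INR j)
  end.

Definition kummer (e q u : R) : R :=
  Series (fun k => pochhammer e k / pochhammer q k * (u ^ k / INR (fact k))).

(* [D] is a region of the (t, S)-plane; classical (C^{1,2}) solutions on [D].
   As [D] is open, only the values of [f] on [D] matter. *)
Definition bachelier_solution (r sigma : R) (D : R * R -> Prop)
    (f : R -> R -> R) : Prop :=
  open D /\
  forall t S : R, D (t, S) ->
    ex_derive (fun t' => f t' S) t /\
    ex_derive (fun S' => f t S') S /\
    ex_derive_n (fun S' => f t S') 2 S /\
    continuous (fun p : R * R => Derive (fun t' => f t' (snd p)) (fst p)) (t, S) /\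
    continuous (fun p : R * R => Derive (fun S' => f (fst p) S') (snd p)) (t, S) /\
    continuous (fun p : R * R => Derive_n (fun S' => f (fst p) S') 2 (snd p)) (t, S) /\
    r * S * Derive (fun S' => f t S') S
      + / 2 * sigma ^ 2 * Derive_n (fun S' => f t S') 2 S
      + Derive (fun t' => f t' S) t - r * f t S = 0.

(* The equation [Phi t S C = 0] has, over each point of [D], exactly one root
   [C], namely [f t S]. *)
Definition determines (D : R * R -> Prop) (Phi : R -> R -> R -> R)
    (f : R -> R -> R) : Prop :=
  forall t S C : R, D (t, S) -> (Phi t S C = 0 <-> C = f t S).

Definition solution (r sigma : R) (D : R * R -> Prop)
    (Phi : R -> R -> R -> R) : Prop :=
  exists f, determines D Phi f /\ bachelier_solution r sigma D f.

(* Elementary functions of (t, S) on [D].  The side conditions make every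
   intermediate operation genuinely defined on [D], so that the default values
   of [/], [ln] and [sqrt] outside their domains play no role.  Real powers are
   covered by [exp] and [ln]. *)
Inductive elementary (D : R * R -> Prop) : (R -> R -> R) -> Prop :=
| elementary_const (c : R) : elementary D (fun _ _ => c)
| elementary_t : elementary D (fun t _ => t)
| elementary_S : elementary D (fun _ S => S)
| elementary_plus f g : elementary D f -> elementary D g ->
    elementary D (fun t S => f t S + g t S)
| elementary_minus f g : elementary D f -> elementary D g ->
    elementary D (fun t S => f t S - g t S)
| elementary_mult f g : elementary D f -> elementary D g ->
    elementary D (fun t S => f t S * g t S)
| elementary_div f g : elementary D f -> elementary D g ->
    (forall t S, D (t, S) -> g t S <> 0) ->
    elementary D (fun t S => f t S / g t S)
| elementary_exp f : elementary D f -> elementary D (fun t S => exp (f t S))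
| elementary_ln f : elementary D f -> (forall t S, D (t, S) -> 0 < f t S) ->
    elementary D (fun t S => ln (f t S))
| elementary_sqrt f : elementary D f -> (forall t S, D (t, S) -> 0 < f t S) ->
    elementary D (fun t S => sqrt (f t S))
| elementary_sin f : elementary D f -> elementary D (fun t S => sin (f t S))
| elementary_cos f : elementary D f -> elementary D (fun t S => cos (f t S))
| elementary_atan f : elementary D f -> elementary D (fun t S => atan (f t S))
| elementary_ext f g : elementary D f ->
    (forall t S, D (t, S) -> f t S = g t S) -> elementary D g.

Definition elementary_solution (r sigma : R) (D : R * R -> Prop)
    (Phi : R -> R -> R -> R) : Prop :=
  exists f, determines D Phi f /\ bachelier_solution r sigma D f /\
    elementary D f.

(* [ck k U f]: [f] is k times continuously differentiable on [U], a set of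
   (eps, t, S, C); meant for open [U]. *)
Fixpoint ck (k : nat) (U : R * R * R * R -> Prop) (f : R * R * R * R -> R)
    : Prop :=
  (forall p, U p -> continuous f p) /\
  match k with
  | O => True
  | Datatypes.S j =>
      exists f1 f2 f3 f4 : R * R * R * R -> R,
        (forall eps t S C : R, U (eps, t, S, C) ->
           is_derive (fun x => f (x, t, S, C)) eps (f1 (eps, t, S, C)) /\
           is_derive (fun x => f (eps, x, S, C)) t (f2 (eps, t, S, C)) /\
           is_derive (fun x => f (eps, t, x, C)) S (f3 (eps, t, S, C)) /\
           is_derive (fun x => f (eps, t, S, x)) C (f4 (eps, t, S, C))) /\
        ck j U f1 /\ ck j U f2 /\ ck j U f3 /\ ck j U f4
  end.

Definition smooth (U : R * R * R * R -> Prop) (f : R * R * R * R -> R) : Prop :=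
  forall k, ck k U f.

(* A family, with parameter the first argument, of locally defined
   transformations (t, S, C) |-> (t', S', C') in which t' and S' do not depend
   on C; [dom eps] is the region of the (t, S)-plane over which the
   transformation of parameter [eps] is considered. *)
Record flow := Flow {
  dom : R -> R * R -> Prop;
  act_t : R -> R -> R -> R;
  act_S : R -> R -> R -> R;
  act_C : R -> R -> R -> R -> R }.

Definition transformed (G : flow) (eps : R) (Phi : R -> R -> R -> R)
    : R -> R -> R -> R :=
  fun t S C => Phi (act_t G eps t S) (act_S G eps t S) (act_C G eps t S C).

Definition transformed_domain (G : flow) (eps : R) (D : R * R -> Prop)
    : R * R -> Prop :=
  fun p => dom G eps p /\
    D (act_t G eps (fst p) (snd p), act_S G eps (fst p) (snd p)).

(* Local one-parameter Lie group of transformations of (t, S, C)-space. *)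
Definition one_parameter_group (G : flow) : Prop :=
  let U := fun p : R * R * R * R =>
    let '(eps, t, s, _) := p in dom G eps (t, s) in
  open U /\
  smooth U (fun p => let '(eps, t, s, _) := p in act_t G eps t s) /\
  smooth U (fun p => let '(eps, t, s, _) := p in act_S G eps t s) /\
  smooth U (fun p => let '(eps, t, s, c) := p in act_C G eps t s c) /\
  (forall t S C, dom G 0 (t, S) /\
     act_t G 0 t S = t /\ act_S G 0 t S = S /\ act_C G 0 t S C = C) /\
  (forall eps t S, dom G eps (t, S) ->
     dom G (- eps) (act_t G eps t S, act_S G eps t S)) /\
  (forall eps delta t S C,
     let t' := act_t G eps t S in
     let S' := act_S G eps t S in
     let C' := act_C G eps t S C in
     dom G eps (t, S) -> dom G delta (t', S') ->
     dom G (eps + delta) (t, S) /\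
     act_t G delta t' S' = act_t G (eps + delta) t S /\
     act_S G delta t' S' = act_S G (eps + delta) t S /\
     act_C G delta t' S' C' = act_C G (eps + delta) t S C).

Definition point_symmetry_group (r sigma : R) (G : flow) : Prop :=
  one_parameter_group G /\
  forall (eps : R) (D : R * R -> Prop) (Phi : R -> R -> R -> R),
    solution r sigma D Phi ->
    solution r sigma (transformed_domain G eps D) (transformed G eps Phi).

Inductive solution_index := q1 | q2 | q3 | q4.

Inductive group_index := i1 | i2 | i3 | i4 | i5 | i6.

Definition whole_plane : R * R -> Prop := fun _ => True.

Definition G (r sigma : R) (i : group_index) : flow :=
  match i with
  | i1 => Flow (fun _ => whole_plane)
      (fun eps t S => t + eps)
      (fun eps t S => S)
      (fun eps t S C => C)
  | i2 => Flow (fun _ => whole_plane)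
      (fun eps t S => t)
      (fun eps t S => S + eps * exp (r * t))
      (fun eps t S C => C)
  | i3 => Flow (fun _ => whole_plane)
      (fun eps t S => t)
      (fun eps t S => S + eps * exp (- r * t))
      (fun eps t S C =>
         exp (- (eps * r * exp (- r * t) * (eps * exp (- r * t) + 2 * S)
                 / sigma ^ 2)) * C)
  | i4 => Flow (fun eps p => 0 < exp (2 * r * fst p) + eps)
      (fun eps t S => ln (exp (2 * r * t) + eps) / (2 * r))
      (fun eps t S => exp (r * t) * S / sqrt (exp (2 * r * t) + eps))
      (fun eps t S C =>
         exp (- (r * (2 * sigma ^ 2 * t * (exp (2 * r * t) + eps) - eps * S ^ 2)
                 / (sigma ^ 2 * (exp (2 * r * t) + eps))))
         * (exp (2 * r * t) + eps) * C)
  | i5 => Flow (fun eps p => 0 < exp (- 2 * r * fst p) + eps)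
      (fun eps t S => - (ln (exp (- 2 * r * t) + eps) / (2 * r)))
      (fun eps t S => exp (- r * t) * S / sqrt (exp (- 2 * r * t) + eps))
      (fun eps t S C => exp (- r * t) * C / sqrt (exp (- 2 * r * t) + eps))
  | i6 => Flow (fun _ => whole_plane)
      (fun eps t S => t)
      (fun eps t S => S)
      (fun eps t S C => exp eps * C)
  end.

(* The values 0, -2, -4, ... of the index n. *)
Definition admissible (n : Z) : Prop := (n <= 0)%Z /\ Z.Even n.

Definition C_fun (r sigma : R) (q : solution_index) (n : Z) (t S : R) : R :=
  let z := r * (S / sigma) ^ 2 in
  match q with
  | q1 => S * kummer (IZR n / 2) (3 / 2) (- z) * exp (IZR n * r * t)
  | q2 => kummer (IZR n / 2) (1 / 2) (- z) * exp ((IZR n + 1) * r * t)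
  | q3 => exp (- z) * S * kummer (IZR n / 2) (3 / 2) z
            * exp (- (IZR n - 3) * r * t)
  | q4 => exp (- z) * kummer (IZR n / 2) (1 / 2) z
            * exp (- (IZR n - 2) * r * t)
  end.

Definition Phi (r sigma : R) (q : solution_index) (n : Z) (t S C : R) : R :=
  C - C_fun r sigma q n t S.

(* A one-parameter family of equations, each recorded by its solution set in
   (t, S, C)-space. *)
Definition equation_family := R -> R -> R -> R -> Prop.

Definition mapped_family (r sigma : R) (q : solution_index) (i : group_index)
    (n : Z) : equation_family :=
  fun eps t S C => dom (G r sigma i) eps (t, S) /\
    transformed (G r sigma i) eps (Phi r sigma q n) t S C = 0.

Definition family_class (r sigma : R) (q : solution_index) (i : group_index)
    : equation_family -> Prop :=
  fun Fam => exists n : Z, admissible n /\ Fam = mapped_family r sigma q i n.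

Definition enumerates {T : Type} (e : nat -> T) (A : T -> Prop) : Prop :=
  (forall m m', e m = e m' -> m = m') /\ (forall x, A x <-> exists m, x = e m).

Definition has_cardinal {T : Type} (A : T -> Prop) (N : nat) : Prop :=
  exists l : list T, NoDup l /\ length l = N /\ forall x, In x l <-> A x.

(* Main.v *)
Require Import Defs.
From Stdlib Require Import Reals ZArith List Lra Lia FinFun.
From Coquelicot Require Import Coquelicot.
Open Scope R_scope.

(** All six groups act on [t] alone, on [S] by an affine map depending on [t],
    and on [C] by a positive factor.  Solving the transformed equation for [C]
    therefore means passing from a solution [f] to
    [exp (a + b S + c S^2) f (tau, alpha S + beta)], with coefficients depending
    on [t], and by the chain rule this is again a solution as soon as the
    coefficients satisfy a first-order system ([lie_system],
    [bachelier_change_of_variables]).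

    The factors on [C] have a common origin.  For each group there is a weight
    [w = (1 + mu) r t - mu r S^2 / sigma^2], with [mu] equal to 0 or 1, such that
    [exp (- w) C] is multiplied by a constant [exp (kappa eps)] only
    ([act_C_weight]).  Consequently the group law for [C] follows from the one
    for [(t, S)], and the system reduces to equations for [tau], [alpha], [beta]
    that are easily checked ([weighted_lie_system], [base_action_affine]).
    Smoothness in all variables holds because the formulas are built from
    functions whose derivatives are of the same kind ([G_smooth]).

    For [n = - 2 m] the Kummer function is a polynomial of degree [m], so the four
    solutions are elementary.  Its partial sums satisfy Kummer's equation up to
    a single monomial ([kummer_sum_defect]), which vanishes here; separation of
    variables then gives the first two solutions.  The other two come from them
    by reflecting the sign of [r] ([reflection_system]), which is one more change
    of variables of the same kind.

    The counting statements rest on invariants of a family.  Its member of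
    parameter 0 is the original solution, whose exponential rate in time
    determines [q] and [n] ([growth_rate_injective]).  The groups [i4] and [i5]
    are recognized by their domains, the others by the initial values at
    parameter 1 for the indices [n = 0] and [n = -2], two being needed because
    some families are degenerate ([group_index_separated]). *)

Set Bullet Behavior "Strict Subproofs".

(* [split] alone would also unfold [is_derive], which is a conjunction. *)
Ltac splits := repeat match goal with |- _ /\ _ => split end.

(** * Solutions and changes of variables *)

(** The statement of [bachelier_solution] in terms of named partial derivatives:
    [is_derive] composes under the chain rule, which the total operator
    [Derive] does not do without differentiability side conditions. *)
Definition classical_solution (r sigma : R) (D : R * R -> Prop)
    (f ft fS fSS : R -> R -> R) : Prop :=
  open D /\
  forall t S, D (t, S) ->
    is_derive (fun t' => f t' S) t (ft t S) /\
    is_derive (fun S' => f t S') S (fS t S) /\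
    is_derive (fun S' => fS t S') S (fSS t S) /\
    continuous (fun p : R * R => ft (fst p) (snd p)) (t, S) /\
    continuous (fun p : R * R => fS (fst p) (snd p)) (t, S) /\
    continuous (fun p : R * R => fSS (fst p) (snd p)) (t, S) /\
    r * S * fS t S + / 2 * sigma ^ 2 * fSS t S + ft t S - r * f t S = 0.

Lemma open_section_S (D : R * R -> Prop) (t S : R) :
  open D -> D (t, S) -> locally S (fun S' => D (t, S')).
Proof.
  intros oD h.
  destruct (oD _ h) as [e he]; exists e; intros S' hS'.
  apply he; split; [apply ball_center | exact hS'].
Qed.

Lemma open_section_t (D : R * R -> Prop) (t S : R) :
  open D -> D (t, S) -> locally t (fun t' => D (t', S)).
Proof.
  intros oD h.
  destruct (oD _ h) as [e he]; exists e; intros t' ht'.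
  apply he; split; [exact ht' | apply ball_center].
Qed.

Lemma bachelier_of_classical (r sigma : R) D f ft fS fSS :
  classical_solution r sigma D f ft fS fSS -> bachelier_solution r sigma D f.
Proof.
  intros [oD H]; split; [exact oD|].
  assert (Ht : forall t S, D (t, S) -> Derive (fun t' => f t' S) t = ft t S)
    by (intros t S h; apply is_derive_unique, H, h).
  assert (HS : forall t S, D (t, S) -> Derive (fun S' => f t S') S = fS t S)
    by (intros t S h; apply is_derive_unique, H, h).
  assert (HSS : forall t S, D (t, S) ->
    is_derive_n (fun S' => f t S') 2 S (fSS t S)).
  { intros t S h; simpl.
    apply (is_derive_ext_loc (fun S' => fS t S')); [|apply H, h].
    generalize (open_section_S D t S oD h); apply filter_imp.
    intros S' h'; symmetry; apply HS, h'. }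
  intros t S h.
  destruct (H t S h) as (h1 & h2 & h3 & h4 & h5 & h6 & h7).
  splits.
  - eexists; exact h1.
  - eexists; exact h2.
  - eexists; exact (HSS t S h).
  - eapply continuous_ext_loc; [|exact h4].
    apply (filter_imp D); [|exact (oD _ h)].
    intros [t' S'] h'; symmetry; apply Ht, h'.
  - eapply continuous_ext_loc; [|exact h5].
    apply (filter_imp D); [|exact (oD _ h)].
    intros [t' S'] h'; symmetry; apply HS, h'.
  - eapply continuous_ext_loc; [|exact h6].
    apply (filter_imp D); [|exact (oD _ h)].
    intros [t' S'] h'; symmetry; apply is_derive_n_unique, HSS, h'.
  - rewrite (Ht t S h), (HS t S h), (is_derive_n_unique _ _ _ _ (HSS t S h)).
    exact h7.
Qed.

Lemma classical_of_bachelier (r sigma : R) D f :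
  bachelier_solution r sigma D f ->
  exists ft fS fSS, classical_solution r sigma D f ft fS fSS.
Proof.
  intros [oD H].
  exists (fun t S => Derive (fun t' => f t' S) t),
    (fun t S => Derive (fun S' => f t S') S),
    (fun t S => Derive_n (fun S' => f t S') 2 S).
  split; [exact oD|].
  intros t S h.
  destruct (H t S h) as (h1 & h2 & h3 & h4 & h5 & h6 & h7).
  splits; try assumption.
  - apply Derive_correct, h1.
  - apply Derive_correct, h2.
  - apply (Derive_correct (fun S' => Derive (fun S'' => f t S'') S')).
    exact h3.
Qed.

Lemma bachelier_ext (r sigma : R) (D D' : R * R -> Prop) f g :
  (forall p, D p <-> D' p) -> (forall t S, D (t, S) -> f t S = g t S) ->
  bachelier_solution r sigma D f -> bachelier_solution r sigma D' g.
Proof.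
  intros HD Hfg hf; apply classical_of_bachelier in hf.
  destruct hf as (ft & fS & fSS & oD & H).
  apply (bachelier_of_classical r sigma D' g ft fS fSS); split.
  - exact (open_ext D D' HD oD).
  - intros t S h; apply HD in h.
    destruct (H t S h) as (h1 & h2 & h3 & h4 & h5 & h6 & h7).
    splits; try assumption.
    + eapply is_derive_ext_loc; [|exact h1].
      generalize (open_section_t D t S oD h); apply filter_imp.
      intros t' h'; apply Hfg, h'.
    + eapply is_derive_ext_loc; [|exact h2].
      generalize (open_section_S D t S oD h); apply filter_imp.
      intros S' h'; apply Hfg, h'.
    + rewrite <- (Hfg t S h); exact h7.
Qed.

(** Continuity of the partial derivatives gives joint differentiability, which
    the chain rule along a moving spatial variable requires. *)
Lemma classical_differentiable (r sigma : R) D f ft fS fSS t S :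
  classical_solution r sigma D f ft fS fSS -> D (t, S) ->
  differentiable_pt_lim f t S (ft t S) (fS t S).
Proof.
  intros [oD H] h; apply filterdiff_differentiable_pt_lim.
  apply (is_derive_filterdiff f t S ft (fS t S)).
  - apply (filter_imp D); [|exact (oD _ h)].
    intros [t' S'] h'; apply H, h'.
  - apply H, h.
  - apply H, h.
Qed.

Lemma continuous_of_is_derive (f f' : R -> R) :
  (forall x, is_derive f x (f' x)) -> forall x, continuous f x.
Proof.
  intros hf x; apply (ex_derive_continuous (V := R_NormedModule)).
  eexists; apply hf.
Qed.

Lemma continuous_of_t (k : R -> R) (t S : R) :
  continuous k t -> continuous (fun p : R * R => k (fst p)) (t, S).
Proof.
  intros hk; apply (continuous_comp fst k); [apply continuous_fst | exact hk].
Qed.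

Lemma continuous_exp_of {X : UniformSpace} (f : X -> R) (x : X) :
  continuous f x -> continuous (fun y => exp (f y)) x.
Proof. intros hf; apply (continuous_comp f exp), continuous_exp; exact hf. Qed.

Ltac real_continuity :=
  simpl;
  repeat match goal with
    | |- continuous _ _ => assumption
    | |- continuous (fun _ => ?c) _ => apply continuous_const
    | |- continuous (fun x => x) _ => apply continuous_id
    | |- continuous (Rmult ?k) _ =>
        apply (continuous_mult (K := R_AbsRing) (fun _ => k) (fun x => x))
    | |- continuous snd _ => apply continuous_snd
    | |- continuous (fun p => exp _) _ => apply continuous_exp_of
    | |- continuous (fun p => _ + _) _ =>
        apply (continuous_plus (V := R_NormedModule))
    | |- continuous (fun p => _ - _) _ =>
        apply (continuous_minus (V := R_NormedModule))
    | |- continuous (fun p => _ * _) _ =>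
        apply (continuous_mult (K := R_AbsRing))
    | |- continuous (fun p => - _) _ =>
        apply (continuous_opp (V := R_NormedModule))
    | |- continuous (fun p => _ (fst p)) _ => apply continuous_of_t; assumption
    end.

Section ChangeOfVariables.

Context (r r0 sigma : R) (T : R -> Prop) (tau alpha beta a b c : R -> R).

(** The determining equations for a change of variables to act on solutions:
    they are what remains when [exp (a + b S + c S^2) f (tau, alpha S + beta)]
    is inserted in the equation of rate [r], [f] being a solution of rate [r0].
    The second-order terms give the equation for [tau], the first-order terms,
    of degrees 1 and 0 in [S], those for [alpha] and [beta], and the terms
    without derivatives of [f], of degrees 0, 1 and 2 in [S], those for [a],
    [b] and [c].  Two different rates are allowed so that the reflection
    [r -> - r] is an instance as well. *)
Definition lie_system : Prop :=
  open T /\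
  forall t, T t ->
    is_derive tau t (alpha t ^ 2) /\
    is_derive alpha t
      (alpha t * (r0 * alpha t ^ 2 - r - 2 * sigma ^ 2 * c t)) /\
    is_derive beta t
      (alpha t ^ 2 * r0 * beta t - sigma ^ 2 * alpha t * b t) /\
    is_derive a t
      (r - r0 * alpha t ^ 2 - sigma ^ 2 * (b t ^ 2 / 2 + c t)) /\
    is_derive b t (- b t * (r + 2 * sigma ^ 2 * c t)) /\
    is_derive c t (- 2 * c t * (r + sigma ^ 2 * c t)).

(** As [tau], [alpha], ..., [c] solve a differential system with polynomial
    right-hand sides, their derivatives are automatically continuous, and the
    three partial derivatives of the new function are continuous
    combinations of those of [f]. *)
Lemma bachelier_change_of_variables (D : R * R -> Prop) (f : R -> R -> R) :
  lie_system -> bachelier_solution r0 sigma D f ->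
  bachelier_solution r sigma
    (fun p => T (fst p) /\
       D (tau (fst p), alpha (fst p) * snd p + beta (fst p)))
    (fun t S => exp (a t + b t * S + c t * S ^ 2)
                * f (tau t) (alpha t * S + beta t)).
Proof.
  intros [oT HL] hf; apply classical_of_bachelier in hf.
  destruct hf as (ft & fS & fSS & hf).
  pose (a' := fun t => r - r0 * alpha t ^ 2 - sigma ^ 2 * (b t ^ 2 / 2 + c t)).
  pose (b' := fun t => - b t * (r + 2 * sigma ^ 2 * c t)).
  pose (c' := fun t => - 2 * c t * (r + sigma ^ 2 * c t)).
  pose (alpha' := fun t =>
    alpha t * (r0 * alpha t ^ 2 - r - 2 * sigma ^ 2 * c t)).
  pose (beta' := fun t =>
    alpha t ^ 2 * r0 * beta t - sigma ^ 2 * alpha t * b t).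
  pose (m := fun t S => exp (a t + b t * S + c t * S ^ 2)).
  pose (X := fun t S => alpha t * S + beta t).
  apply (bachelier_of_classical r sigma _ _
    (fun t S => m t S * ((a' t + b' t * S + c' t * S ^ 2) * f (tau t) (X t S)
       + alpha t ^ 2 * ft (tau t) (X t S)
       + (alpha' t * S + beta' t) * fS (tau t) (X t S)))
    (fun t S => m t S * ((b t + 2 * c t * S) * f (tau t) (X t S)
       + alpha t * fS (tau t) (X t S)))
    (fun t S => m t S * (((b t + 2 * c t * S) ^ 2 + 2 * c t) * f (tau t) (X t S)
       + 2 * (b t + 2 * c t * S) * alpha t * fS (tau t) (X t S)
       + alpha t ^ 2 * fSS (tau t) (X t S)))).
  assert (Hc : forall t, T t -> continuous tau t /\ continuous alpha t /\
    continuous beta t /\ continuous a t /\ continuous b t /\ continuous c t).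
  { intros t ht; destruct (HL t ht) as (h1 & h2 & h3 & h4 & h5 & h6).
    splits; apply (ex_derive_continuous (V := R_NormedModule));
      eexists; eassumption. }
  assert (HX : forall t S, T t ->
    continuous (fun p : R * R => (tau (fst p), X (fst p) (snd p))) (t, S)).
  { intros t S ht; destruct (Hc t ht) as (h1 & h2 & h3 & _).
    apply (continuous_comp_2 (fun p : R * R => tau (fst p))
      (fun p => X (fst p) (snd p)) (fun x y => (x, y))).
    - apply continuous_of_t, h1.
    - unfold X; real_continuity.
    - apply (continuous_ext (fun p : R * R => p));
        [now intros [] | apply continuous_id]. }
  split.
  - intros [t S] [ht hD].
    apply filter_and.
    + apply (continuous_fst t S), (oT t ht).
    + apply (HX t S ht), (proj1 hf _ hD).
  - intros t S [ht hD]; simpl in ht, hD.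
    destruct (Hc t ht) as (c1 & c2 & c3 & c4 & c5 & c6).
    destruct (HL t ht) as (h1 & h2 & h3 & h4 & h5 & h6).
    pose proof (classical_differentiable _ _ _ _ _ _ _ _ _ hf hD) as hd.
    destruct (proj2 hf _ _ hD) as (f1 & f2 & f3 & f4 & f5 & f6 & f7).
    assert (Cf : forall g : R -> R -> R,
      continuous (fun p : R * R => g (fst p) (snd p)) (tau t, X t S) ->
      continuous (fun p : R * R => g (tau (fst p)) (X (fst p) (snd p))) (t, S)).
    { intros g hg.
      apply (continuous_comp
        (fun p : R * R => (tau (fst p), X (fst p) (snd p)))
        (fun p => g (fst p) (snd p))); [apply HX, ht | exact hg]. }
    pose proof (Cf _ f4) as C4; pose proof (Cf _ f5) as C5;
      pose proof (Cf _ f6) as C6.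
    assert (C0 : continuous
      (fun p : R * R => f (tau (fst p)) (X (fst p) (snd p))) (t, S)).
    { apply Cf.
      apply (proj1 (continuity_2d_pt_filterlim f (tau t) (X t S))).
      apply differentiable_continuity_pt; eexists; eexists; exact hd. }
    assert (Cm : continuous (fun p : R * R => m (fst p) (snd p)) (t, S)).
    { unfold m; real_continuity. }
    assert (DX : is_derive (fun S' => X t S') S (alpha t))
      by (unfold X; auto_derive; [exact I | ring]).
    assert (Dcomp : forall (g : R -> R -> R) l,
      is_derive (fun S' => g (tau t) S') (X t S) l ->
      is_derive (fun S' => g (tau t) (X t S')) S (alpha t * l)).
    { intros g l hg.
      exact (is_derive_comp (fun S' => g (tau t) S') _ _ _ _ hg DX). }
    pose proof (Dcomp _ _ f2) as D2; pose proof (Dcomp _ _ f3) as D3.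
    assert (Dm : is_derive (fun S' => m t S') S (m t S * (b t + 2 * c t * S)))
      by (unfold m; auto_derive; [exact I | simpl; ring]).
    splits.
    + assert (Dmt : is_derive (fun t' => m t' S) t
        (m t S * (a' t + b' t * S + c' t * S ^ 2))).
      { unfold m; auto_derive.
        - splits; eexists; eassumption.
        - rewrite (is_derive_unique (fun x : R => a x) t _ h4),
            (is_derive_unique (fun x : R => b x) t _ h5),
            (is_derive_unique (fun x : R => c x) t _ h6).
          unfold a', b', c'; simpl; ring. }
      assert (DXt : is_derive (fun t' => X t' S) t (alpha' t * S + beta' t)).
      { unfold X; auto_derive.
        - splits; eexists; eassumption.
        - rewrite (is_derive_unique (fun x : R => alpha x) t _ h2),
            (is_derive_unique (fun x : R => beta x) t _ h3);
            unfold alpha', beta'; ring. }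
      apply is_derive_Reals in h1; apply is_derive_Reals in DXt;
        apply is_derive_Reals in Dmt.
      pose proof (derivable_pt_lim_comp_2d f tau (fun t' => X t' S) t _ _ _ _
        hd h1 DXt) as hcomp.
      pose proof (derivable_pt_lim_mult _ _ _ _ _ Dmt hcomp) as hmul.
      apply is_derive_Reals in hmul; evar_last; [exact hmul|].
      unfold X; ring.
    + pose proof (is_derive_mult _ _ _ _ _ Dm D2 Rmult_comm) as hmul.
      evar_last; [exact hmul|].
      unfold plus, mult; simpl; unfold X; ring.
    + pose proof (is_derive_mult _ _ _ _ _ Dm
        (is_derive_plus _ _ _ _ _
          (is_derive_mult (fun S' => b t + 2 * c t * S') _ S (2 * c t) _
             ltac:(auto_derive; [exact I | ring]) D2 Rmult_comm)
          (is_derive_scal _ _ (alpha t) _ D3)) Rmult_comm) as hmul.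
      evar_last; [exact hmul|].
      unfold plus, mult; simpl; unfold X; ring.
    + unfold a', b', c', alpha', beta'; unfold Rdiv; real_continuity.
    + real_continuity.
    + real_continuity.
    + (* The system is exactly what makes the terms that are not a multiple of
         the equation for [f] at the image point cancel. *)
      fold (m t S) (X t S) in *.
      transitivity (m t S * alpha t ^ 2 *
        (r0 * X t S * fS (tau t) (X t S)
         + / 2 * sigma ^ 2 * fSS (tau t) (X t S)
         + ft (tau t) (X t S) - r0 * f (tau t) (X t S))).
      * unfold a', b', c', alpha', beta', X; field.
      * rewrite f7; ring.
Qed.

End ChangeOfVariables.

(** * Kummer polynomials and the four solutions *)

Definition kummer_coef (e q : R) (k : nat) : R :=
  pochhammer e k / pochhammer q k / INR (fact k).

Definition kummer_sum (e q : R) (N : nat) (u : R) : R :=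
  sum_f_R0 (fun k => kummer_coef e q k * u ^ k) N.

Definition kummer_sum' (e q : R) (N : nat) (u : R) : R :=
  sum_f_R0 (fun k => kummer_coef e q k * (INR k * u ^ pred k)) N.

Definition kummer_sum'' (e q : R) (N : nat) (u : R) : R :=
  sum_f_R0 (fun k =>
    kummer_coef e q k * (INR k * (INR (pred k) * u ^ pred (pred k)))) N.

Lemma pochhammer_pos (q : R) (k : nat) : 0 < q -> 0 < pochhammer q k.
Proof.
  intros hq; induction k as [|k IH]; simpl; [lra|].
  apply Rmult_lt_0_compat; [exact IH|]; pose proof (pos_INR k); lra.
Qed.

Lemma pochhammer_neg_nat (m k : nat) :
  (m < k)%nat -> pochhammer (- INR m) k = 0.
Proof.
  induction 1 as [|k _ IH]; simpl; [ring | rewrite IH; ring].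
Qed.

Lemma kummer_coef_S (e q : R) (k : nat) : 0 < q ->
  kummer_coef e q (S k) * ((q + INR k) * INR (S k))
  = kummer_coef e q k * (e + INR k).
Proof.
  intros hq; unfold kummer_coef.
  change (fact (S k)) with ((S k) * fact k)%nat; rewrite mult_INR.
  change (pochhammer ?w (S k)) with (pochhammer w k * (w + INR k)).
  pose proof (pochhammer_pos q k hq).
  pose proof (INR_fact_lt_0 k); pose proof (pos_INR k).
  rewrite S_INR; simpl.
  field; repeat split; lra.
Qed.

Lemma kummer_terminates (m : nat) (q u : R) :
  kummer (- INR m) q u = kummer_sum (- INR m) q m u.
Proof.
  unfold kummer; apply is_series_unique.
  refine (is_lim_seq_ext_loc (fun _ => kummer_sum (- INR m) q m u) _
    (kummer_sum (- INR m) q m u) _ (is_lim_seq_const _)).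
  exists m; intros N hN; rewrite sum_n_Reals; unfold kummer_sum.
  induction hN as [|N hN IH].
  - apply sum_eq; intros k _; unfold kummer_coef, Rdiv; ring.
  - rewrite IH, tech5, pochhammer_neg_nat by lia; unfold Rdiv; ring.
Qed.

Lemma is_derive_sum_f_R0 (f f' : nat -> R -> R) (N : nat) (u : R) :
  (forall k, is_derive (f k) u (f' k u)) ->
  is_derive (fun v => sum_f_R0 (fun k => f k v) N) u
    (sum_f_R0 (fun k => f' k u) N).
Proof.
  intros hf; induction N as [|N IH]; [apply hf|].
  exact (is_derive_plus (K := R_AbsRing) (V := R_NormedModule) _ _ _ _ _
    IH (hf (S N))).
Qed.

Lemma is_derive_kummer_sum (e q : R) (N : nat) (u : R) :
  is_derive (kummer_sum e q N) u (kummer_sum' e q N u).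
Proof.
  apply (is_derive_sum_f_R0 (fun k v => kummer_coef e q k * v ^ k)
    (fun k v => kummer_coef e q k * (INR k * v ^ pred k))).
  intros k; auto_derive; [exact I | ring].
Qed.

Lemma is_derive_kummer_sum' (e q : R) (N : nat) (u : R) :
  is_derive (kummer_sum' e q N) u (kummer_sum'' e q N u).
Proof.
  apply (is_derive_sum_f_R0
    (fun k v => kummer_coef e q k * (INR k * v ^ pred k))
    (fun k v => kummer_coef e q k * (INR k * (INR (pred k) * v ^ pred (pred k))))).
  intros k; auto_derive; [exact I | ring].
Qed.

Lemma continuous_kummer_sum'' (e q : R) (N : nat) (u : R) :
  continuous (kummer_sum'' e q N) u.
Proof.
  apply (ex_derive_continuous (V := R_NormedModule)); eexists.
  apply (is_derive_sum_f_R0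
    (fun k v => kummer_coef e q k * (INR k * (INR (pred k) * v ^ pred (pred k))))
    (fun k v => kummer_coef e q k * (INR k * (INR (pred k) *
       (INR (pred (pred k)) * v ^ pred (pred (pred k))))))).
  intros k; auto_derive; [exact I | ring].
Qed.

(** Truncating the hypergeometric series leaves a defect of a single monomial in
    Kummer's equation: by the recurrence of the coefficients the contributions
    of consecutive terms telescope.  For [e = - INR N] the defect vanishes. *)
Lemma kummer_sum_defect (e q : R) (N : nat) (u : R) : 0 < q ->
  u * kummer_sum'' e q N u + (q - u) * kummer_sum' e q N u
    - e * kummer_sum e q N u
  = - (e + INR N) * kummer_coef e q N * u ^ N.
Proof.
  intros hq; unfold kummer_sum, kummer_sum', kummer_sum''.
  induction N as [|N IH]; [simpl; ring|].
  rewrite !tech5.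
  match goal with |- u * (?x + ?x1) + (q - u) * (?y + ?y1) - e * (?z + ?z1) = _
    => transitivity ((u * x + (q - u) * y - e * z)
         + (u * x1 + (q - u) * y1 - e * z1)); [ring|] end.
  rewrite IH; clear IH.
  transitivity (- (kummer_coef e q N * (e + INR N)) * u ^ N
    + kummer_coef e q (S N) * ((q + INR N) * INR (S N)) * u ^ N
    - (e + INR (S N)) * kummer_coef e q (S N) * u ^ S N).
  - simpl pred.
    destruct N as [|N]; [simpl; ring|].
    rewrite <- !tech_pow_Rmult; simpl pred; rewrite !S_INR; ring.
  - rewrite kummer_coef_S by exact hq; ring.
Qed.

Lemma kummer_polynomial (m : nat) (q : R) : 0 < q ->
  exists K1 K2 : R -> R,
    (forall u, is_derive (kummer (- INR m) q) u (K1 u)) /\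
    (forall u, is_derive K1 u (K2 u)) /\
    (forall u, continuous K2 u) /\
    (forall u, u * K2 u + (q - u) * K1 u - (- INR m) * kummer (- INR m) q u = 0).
Proof.
  intros hq.
  exists (kummer_sum' (- INR m) q m), (kummer_sum'' (- INR m) q m).
  splits; intros u.
  - apply (is_derive_ext (kummer_sum (- INR m) q m));
      [intros; symmetry; apply kummer_terminates | apply is_derive_kummer_sum].
  - apply is_derive_kummer_sum'.
  - apply continuous_kummer_sum''.
  - rewrite kummer_terminates, kummer_sum_defect by exact hq; ring.
Qed.

Lemma kummer_at_0 (m : nat) (q : R) : kummer (- INR m) q 0 = 1.
Proof.
  rewrite kummer_terminates; unfold kummer_sum.
  generalize (- INR m); intros e; induction m as [|m IH].
  - simpl; unfold kummer_coef; simpl; field.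
  - rewrite tech5, IH, pow_i by lia; ring.
Qed.

(** Separation of variables reduces the equation to an ordinary one in [S]. *)
Lemma separated_solution (r sigma mu : R) (A A1 A2 : R -> R) :
  (forall S, is_derive A S (A1 S)) -> (forall S, is_derive A1 S (A2 S)) ->
  (forall S, continuous A2 S) ->
  (forall S, r * S * A1 S + / 2 * sigma ^ 2 * A2 S + (mu - r) * A S = 0) ->
  bachelier_solution r sigma whole_plane (fun t S => A S * exp (mu * t)).
Proof.
  intros h1 h2 h3 h4.
  apply (bachelier_of_classical r sigma _ _ (fun t S => mu * A S * exp (mu * t))
    (fun t S => A1 S * exp (mu * t)) (fun t S => A2 S * exp (mu * t))).
  assert (hmul : forall B B1 : R -> R, (forall S, is_derive B S (B1 S)) ->
    forall S k, is_derive (fun S' => B S' * k) S (B1 S * k)).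
  { intros B B1 hB S k.
    apply (is_derive_ext (fun S' => k * B S')); [intros; apply Rmult_comm|].
    rewrite Rmult_comm; apply is_derive_scal, hB. }
  assert (hcont : forall B : R -> R, (forall S, continuous B S) -> forall t S,
    continuous (fun p : R * R => B (snd p) * exp (mu * fst p)) (t, S)).
  { intros B hB t S; apply (continuous_mult (K := R_AbsRing)).
    - apply (continuous_comp snd B); [apply continuous_snd | apply hB].
    - apply (continuous_of_t (fun t => exp (mu * t))).
      apply (ex_derive_continuous (V := R_NormedModule)); auto_derive; exact I. }
  split; [apply open_true|].
  intros t S _; splits.
  - auto_derive; [exact I | ring].
  - apply hmul, h1.
  - apply hmul, h2.
  - apply (continuous_ext
      (fun p : R * R => mu * (A (snd p) * exp (mu * fst p))));
      [intros; simpl; ring|].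
    apply (continuous_mult (K := R_AbsRing)); [apply continuous_const|].
    apply hcont, (continuous_of_is_derive _ _ h1).
  - apply hcont, (continuous_of_is_derive _ _ h2).
  - apply hcont, h3.
  - transitivity (exp (mu * t) * (r * S * A1 S + / 2 * sigma ^ 2 * A2 S
      + (mu - r) * A S)); [ring | rewrite h4; ring].
Qed.

(** The even integers [n <= 0] are the indices for which the first Kummer
    parameter [n / 2] makes the series terminate. *)
Lemma index_half (n : Z) : admissible n -> exists m : nat,
  n = (- 2 * Z.of_nat m)%Z /\ IZR n / 2 = - INR m.
Proof.
  intros [hn [k ->]]; exists (Z.to_nat (- k)); split; [lia|].
  rewrite INR_IZR_INZ, Z2Nat.id, mult_IZR, opp_IZR by lia; field.
Qed.

(** In the variable [w = - r (S / sigma)^2] the separated equation is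
    Kummer's equation with second parameter 3/2, up to the factor [- 2 r S]. *)
Lemma C_fun_q1_solution (r sigma : R) (n : Z) :
  sigma <> 0 -> admissible n ->
  bachelier_solution r sigma whole_plane (C_fun r sigma q1 n).
Proof.
  intros hs hn; destruct (index_half n hn) as (m & _ & hm).
  destruct (kummer_polynomial m (3 / 2) ltac:(lra))
    as (K1 & K2 & hK & hK1 & cK2 & hode).
  unfold C_fun; rewrite <- hm in hK, hode.
  revert hK hode; generalize (kummer (IZR n / 2) (3 / 2)); intros K hK hode.
  set (w := fun S => - (r * (S / sigma) ^ 2)).
  assert (hw : forall S, is_derive w S (- 2 * r * S / sigma ^ 2)).
  { intros S; unfold w; auto_derive; [exact I | field; exact hs]. }
  apply (separated_solution r sigma (IZR n * r) (fun S => S * K (w S))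
    (fun S => K (w S) + 2 * w S * K1 (w S))
    (fun S => - 2 * r * S / sigma ^ 2 * (3 * K1 (w S) + 2 * w S * K2 (w S)))).
  - intros S; auto_derive; [splits; eexists; eauto|].
    rewrite (is_derive_unique (fun x : R => K x) (w S) _ (hK _)),
      (is_derive_unique (fun x : R => w x) S _ (hw S)).
    unfold w; field; exact hs.
  - intros S; auto_derive; [splits; eexists; eauto|].
    rewrite (is_derive_unique (fun x : R => K x) (w S) _ (hK _)),
      (is_derive_unique (fun x : R => K1 x) (w S) _ (hK1 _)),
      (is_derive_unique (fun x : R => w x) S _ (hw S)).
    field; exact hs.
  - intros S.
    pose proof (continuous_of_is_derive _ _ hw S) as cw.
    assert (cK : continuous (fun x => K1 (w x)) S)
      by (apply (continuous_comp w K1);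
          [exact cw | apply (continuous_of_is_derive _ _ hK1)]).
    assert (cK' : continuous (fun x => K2 (w x)) S)
      by (apply (continuous_comp w K2); [exact cw | apply cK2]).
    unfold Rdiv; real_continuity.
  - intros S.
    transitivity (- 2 * r * S * (w S * K2 (w S) + (3 / 2 - w S) * K1 (w S)
      - IZR n / 2 * K (w S))); [unfold w; field; exact hs|].
    rewrite hode; ring.
Qed.

(** As for the odd solutions, now with second parameter 1/2 and factor
    [- 2 r]. *)
Lemma C_fun_q2_solution (r sigma : R) (n : Z) :
  sigma <> 0 -> admissible n ->
  bachelier_solution r sigma whole_plane (C_fun r sigma q2 n).
Proof.
  intros hs hn; destruct (index_half n hn) as (m & _ & hm).
  destruct (kummer_polynomial m (1 / 2) ltac:(lra))
    as (K1 & K2 & hK & hK1 & cK2 & hode).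
  unfold C_fun; rewrite <- hm in hK, hode.
  revert hK hode; generalize (kummer (IZR n / 2) (1 / 2)); intros K hK hode.
  set (w := fun S => - (r * (S / sigma) ^ 2)).
  assert (hw : forall S, is_derive w S (- 2 * r * S / sigma ^ 2)).
  { intros S; unfold w; auto_derive; [exact I | field; exact hs]. }
  apply (separated_solution r sigma ((IZR n + 1) * r) (fun S => K (w S))
    (fun S => - 2 * r / sigma ^ 2 * (S * K1 (w S)))
    (fun S => - 2 * r / sigma ^ 2 * (K1 (w S) + 2 * w S * K2 (w S)))).
  - intros S; auto_derive; [splits; eexists; eauto|].
    rewrite (is_derive_unique (fun x : R => K x) (w S) _ (hK _)),
      (is_derive_unique (fun x : R => w x) S _ (hw S)).
    field; exact hs.
  - intros S; auto_derive; [splits; eexists; eauto|].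
    rewrite (is_derive_unique (fun x : R => K1 x) (w S) _ (hK1 _)),
      (is_derive_unique (fun x : R => w x) S _ (hw S)).
    unfold w; field; exact hs.
  - intros S.
    pose proof (continuous_of_is_derive _ _ hw S) as cw.
    assert (cK : continuous (fun x => K1 (w x)) S)
      by (apply (continuous_comp w K1);
          [exact cw | apply (continuous_of_is_derive _ _ hK1)]).
    assert (cK' : continuous (fun x => K2 (w x)) S)
      by (apply (continuous_comp w K2); [exact cw | apply cK2]).
    unfold Rdiv; real_continuity.
  - intros S.
    transitivity (- 2 * r * (w S * K2 (w S) + (1 / 2 - w S) * K1 (w S)
      - IZR n / 2 * K (w S))); [unfold w; field; exact hs|].
    rewrite hode; ring.
Qed.

(** Multiplication by [exp (3 r t - r S^2 / sigma^2)] carries the equation of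
    rate [- r] to that of rate [r]; it is how the Gaussian solutions [q3] and
    [q4] arise from the polynomial ones [q1] and [q2]. *)
Lemma reflection_system (r sigma : R) : sigma <> 0 ->
  lie_system r (- r) sigma (fun _ => True) (fun t => t) (fun _ => 1)
    (fun _ => 0) (fun t => 3 * r * t) (fun _ => 0) (fun _ => - r / sigma ^ 2).
Proof.
  intros hs; split; [apply open_true|].
  intros t _; splits; auto_derive; auto; field; exact hs.
Qed.

Lemma C_fun_q3_reflection (r sigma : R) (n : Z) (t S : R) : sigma <> 0 ->
  C_fun r sigma q3 n t S
  = exp (3 * r * t + 0 * S + - r / sigma ^ 2 * S ^ 2)
    * C_fun (- r) sigma q1 n t (1 * S + 0).
Proof.
  intros hs; unfold C_fun.
  replace (1 * S + 0) with S by ring.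
  replace (- (- r * (S / sigma) ^ 2)) with (r * (S / sigma) ^ 2) by ring.
  replace (3 * r * t + 0 * S + - r / sigma ^ 2 * S ^ 2)
    with (- (r * (S / sigma) ^ 2) + 3 * r * t) by (field; exact hs).
  replace (- (IZR n - 3) * r * t) with (3 * r * t + IZR n * - r * t) by ring.
  rewrite !exp_plus; ring.
Qed.

Lemma C_fun_q4_reflection (r sigma : R) (n : Z) (t S : R) : sigma <> 0 ->
  C_fun r sigma q4 n t S
  = exp (3 * r * t + 0 * S + - r / sigma ^ 2 * S ^ 2)
    * C_fun (- r) sigma q2 n t (1 * S + 0).
Proof.
  intros hs; unfold C_fun.
  replace (1 * S + 0) with S by ring.
  replace (- (- r * (S / sigma) ^ 2)) with (r * (S / sigma) ^ 2) by ring.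
  replace (3 * r * t + 0 * S + - r / sigma ^ 2 * S ^ 2)
    with (- (r * (S / sigma) ^ 2) + 3 * r * t) by (field; exact hs).
  replace (- (IZR n - 2) * r * t) with (3 * r * t + (IZR n + 1) * - r * t)
    by ring.
  rewrite !exp_plus; ring.
Qed.

Lemma C_fun_solution (r sigma : R) (q : solution_index) (n : Z) :
  sigma <> 0 -> admissible n ->
  bachelier_solution r sigma whole_plane (C_fun r sigma q n).
Proof.
  intros hs hn; destruct q.
  - apply C_fun_q1_solution; assumption.
  - apply C_fun_q2_solution; assumption.
  - refine (bachelier_ext r sigma _ _ _ _ _ _
      (bachelier_change_of_variables _ _ _ _ _ _ _ _ _ _ _ _
        (reflection_system r sigma hs) (C_fun_q1_solution (- r) sigma n hs hn))).
    + now split.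
    + intros; symmetry; apply C_fun_q3_reflection, hs.
  - refine (bachelier_ext r sigma _ _ _ _ _ _
      (bachelier_change_of_variables _ _ _ _ _ _ _ _ _ _ _ _
        (reflection_system r sigma hs) (C_fun_q2_solution (- r) sigma n hs hn))).
    + now split.
    + intros; symmetry; apply C_fun_q4_reflection, hs.
Qed.

(** * Smoothness of the group actions *)

Lemma ck_pred (U : R * R * R * R -> Prop) (k : nat) f :
  ck (S k) U f -> ck k U f.
Proof.
  revert f; induction k as [|k IH]; intros f [hf hd]; split;
    [exact hf | exact I | exact hf|].
  destruct hd as (f1 & f2 & f3 & f4 & hd & h1 & h2 & h3 & h4).
  exists f1, f2, f3, f4; splits; auto.
Qed.

Lemma ck_ext (U : R * R * R * R -> Prop) (k : nat) f g :
  (forall p, f p = g p) -> ck k U f -> ck k U g.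
Proof.
  intros hfg hf; destruct k as [|k]; destruct hf as [hf hd]; split;
    [| exact I | |].
  1, 2 : intros p hp; apply (continuous_ext f); auto.
  destruct hd as (f1 & f2 & f3 & f4 & hd & h).
  exists f1, f2, f3, f4; split; [|exact h].
  intros eps t s c hp; destruct (hd eps t s c hp) as (d1 & d2 & d3 & d4).
  splits; eapply is_derive_ext; try eassumption; intros; apply hfg.
Qed.

Lemma ck_const (U : R * R * R * R -> Prop) (k : nat) (v : R) :
  ck k U (fun _ => v).
Proof.
  revert v; induction k as [|k IH]; intros v;
    (split; [intros; apply continuous_const|]); [exact I|].
  exists (fun _ => 0), (fun _ => 0), (fun _ => 0), (fun _ => 0).
  splits; auto; intros; splits; apply (is_derive_const (V := R_NormedModule)).
Qed.

Lemma ck_eps (U : R * R * R * R -> Prop) (k : nat) :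
  ck k U (fun p => fst (fst (fst p))).
Proof.
  destruct k; split; [|exact I| |].
  1, 2 : intros [[[eps t] s] c] _;
    apply (continuous_comp (fun p => fst (fst p)) fst);
    [apply (continuous_comp fst fst)|]; apply continuous_fst.
  exists (fun _ => 1), (fun _ => 0), (fun _ => 0), (fun _ => 0).
  splits; try apply ck_const.
  intros; simpl; splits;
    [apply (is_derive_id (K := R_AbsRing))|..];
    apply (is_derive_const (V := R_NormedModule)).
Qed.

Lemma ck_t (U : R * R * R * R -> Prop) (k : nat) :
  ck k U (fun p => snd (fst (fst p))).
Proof.
  destruct k; split; [|exact I| |].
  1, 2 : intros [[[eps t] s] c] _;
    apply (continuous_comp (fun p => fst (fst p)) snd);
    [apply (continuous_comp fst fst); apply continuous_fst
    | apply continuous_snd].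
  exists (fun _ => 0), (fun _ => 1), (fun _ => 0), (fun _ => 0).
  splits; try apply ck_const.
  intros; simpl; splits; try apply (is_derive_id (K := R_AbsRing));
    apply (is_derive_const (V := R_NormedModule)).
Qed.

Lemma ck_S (U : R * R * R * R -> Prop) (k : nat) :
  ck k U (fun p => snd (fst p)).
Proof.
  destruct k; split; [|exact I| |].
  1, 2 : intros [[[eps t] s] c] _; apply (continuous_comp fst snd);
    [apply continuous_fst | apply continuous_snd].
  exists (fun _ => 0), (fun _ => 0), (fun _ => 1), (fun _ => 0).
  splits; try apply ck_const.
  intros; simpl; splits; try apply (is_derive_id (K := R_AbsRing));
    apply (is_derive_const (V := R_NormedModule)).
Qed.

Lemma ck_C (U : R * R * R * R -> Prop) (k : nat) : ck k U (fun p => snd p).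
Proof.
  destruct k; split; [|exact I| |].
  1, 2 : intros [[[eps t] s] c] _; apply continuous_snd.
  exists (fun _ => 0), (fun _ => 0), (fun _ => 0), (fun _ => 1).
  splits; try apply ck_const.
  intros; simpl; splits; try apply (is_derive_id (K := R_AbsRing));
    apply (is_derive_const (V := R_NormedModule)).
Qed.

Lemma ck_plus (U : R * R * R * R -> Prop) (k : nat) f g :
  ck k U f -> ck k U g -> ck k U (fun p => f p + g p).
Proof.
  revert f g; induction k as [|k IH]; intros f g [hf df] [hg dg]; split;
    try exact I.
  1, 2 : intros p hp; apply (continuous_plus (V := R_NormedModule)); auto.
  destruct df as (f1 & f2 & f3 & f4 & df & F1 & F2 & F3 & F4).
  destruct dg as (g1 & g2 & g3 & g4 & dg & G1 & G2 & G3 & G4).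
  exists (fun p => f1 p + g1 p), (fun p => f2 p + g2 p),
    (fun p => f3 p + g3 p), (fun p => f4 p + g4 p).
  splits; auto.
  intros eps t s c hp; destruct (df eps t s c hp) as (? & ? & ? & ?);
    destruct (dg eps t s c hp) as (? & ? & ? & ?); splits;
    apply (is_derive_plus (K := R_AbsRing) (V := R_NormedModule)); assumption.
Qed.

Lemma ck_mult (U : R * R * R * R -> Prop) (k : nat) f g :
  ck k U f -> ck k U g -> ck k U (fun p => f p * g p).
Proof.
  revert f g; induction k as [|k IH]; intros f g hf hg.
  { split; [|exact I]; intros p hp; apply (continuous_mult (K := R_AbsRing));
      [apply hf, hp | apply hg, hp]. }
  pose proof (ck_pred U k f hf) as hf0; pose proof (ck_pred U k g hg) as hg0.
  destruct hf as [hf df]; destruct hg as [hg dg]; split.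
  - intros p hp; apply (continuous_mult (K := R_AbsRing)); auto.
  - destruct df as (f1 & f2 & f3 & f4 & df & F1 & F2 & F3 & F4).
    destruct dg as (g1 & g2 & g3 & g4 & dg & G1 & G2 & G3 & G4).
    exists (fun p => f1 p * g p + f p * g1 p),
      (fun p => f2 p * g p + f p * g2 p),
      (fun p => f3 p * g p + f p * g3 p), (fun p => f4 p * g p + f p * g4 p).
    splits; try (apply ck_plus; apply IH; assumption).
    intros eps t s c hp; destruct (df eps t s c hp) as (? & ? & ? & ?);
      destruct (dg eps t s c hp) as (? & ? & ? & ?); splits;
      apply (is_derive_mult (K := R_AbsRing)); auto using Rmult_comm.
Qed.

(** The step of an induction on [k]: regularity of [phi] composed with [f] follows
    from that of [phi'] composed with [f].  For [exp], [/], [sqrt] and [ln] the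
    derivative is expressed by the function itself or by one treated before. *)
Lemma ck_comp (U : R * R * R * R -> Prop) (V : R -> Prop) (phi phi' : R -> R)
    (k : nat) f :
  (forall x, V x -> is_derive phi x (phi' x)) ->
  (forall p, U p -> V (f p)) ->
  ck (S k) U f -> ck k U (fun p => phi' (f p)) ->
  ck (S k) U (fun p => phi (f p)).
Proof.
  intros hphi hV [hf df] hc; split.
  - intros p hp; apply (continuous_comp f phi); [apply hf, hp|].
    apply (ex_derive_continuous (V := R_NormedModule)).
    eexists; apply hphi, hV, hp.
  - destruct df as (f1 & f2 & f3 & f4 & df & F1 & F2 & F3 & F4).
    exists (fun p => f1 p * phi' (f p)), (fun p => f2 p * phi' (f p)),
      (fun p => f3 p * phi' (f p)), (fun p => f4 p * phi' (f p)).
    splits; try (apply ck_mult; assumption).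
    intros eps t s c hp; destruct (df eps t s c hp) as (d1 & d2 & d3 & d4).
    pose proof (hphi _ (hV _ hp)) as h.
    splits.
    + exact (is_derive_comp phi (fun x => f (x, t, s, c)) eps _ _ h d1).
    + exact (is_derive_comp phi (fun x => f (eps, x, s, c)) t _ _ h d2).
    + exact (is_derive_comp phi (fun x => f (eps, t, x, c)) s _ _ h d3).
    + exact (is_derive_comp phi (fun x => f (eps, t, s, x)) c _ _ h d4).
Qed.

Lemma ck_0_comp (U : R * R * R * R -> Prop) (V : R -> Prop) (phi phi' : R -> R)
    f :
  (forall x, V x -> is_derive phi x (phi' x)) ->
  (forall p, U p -> V (f p)) ->
  ck 0 U f -> ck 0 U (fun p => phi (f p)).
Proof.
  intros hphi hV [hf _]; split; [|exact I].
  intros p hp; apply (continuous_comp f phi); [apply hf, hp|].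
  apply (ex_derive_continuous (V := R_NormedModule)).
  eexists; apply hphi, hV, hp.
Qed.

Lemma ck_exp (U : R * R * R * R -> Prop) (k : nat) f :
  ck k U f -> ck k U (fun p => exp (f p)).
Proof.
  revert f; induction k as [|k IH]; intros f hf.
  - apply (ck_0_comp U (fun _ => True) exp exp); auto.
    intros; apply is_derive_exp.
  - apply (ck_comp U (fun _ => True) exp exp); auto.
    + intros; apply is_derive_exp.
    + apply IH, ck_pred, hf.
Qed.

Lemma ck_inv (U : R * R * R * R -> Prop) (k : nat) f :
  (forall p, U p -> f p <> 0) -> ck k U f -> ck k U (fun p => / f p).
Proof.
  intros hU.
  assert (hd : forall x, x <> 0 -> is_derive Rinv x (-1 * (/ x * / x))).
  { intros x hx; auto_derive; [exact hx | field; exact hx]. }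
  induction k as [|k IH]; intros hf.
  - apply (ck_0_comp U _ Rinv _ f hd hU hf).
  - apply (ck_comp U _ Rinv _ k f hd hU hf).
    pose proof (IH (ck_pred U k f hf)).
    apply ck_mult; [apply ck_const | apply ck_mult; assumption].
Qed.

Lemma ck_ln (U : R * R * R * R -> Prop) (k : nat) f :
  (forall p, U p -> 0 < f p) -> ck k U f -> ck k U (fun p => ln (f p)).
Proof.
  intros hU hf; destruct k as [|k].
  - apply (ck_0_comp U _ ln _ f is_derive_ln hU hf).
  - apply (ck_comp U _ ln _ k f is_derive_ln hU hf).
    apply ck_inv; [|apply ck_pred, hf].
    intros p hp; apply Rgt_not_eq, hU, hp.
Qed.

Lemma ck_sqrt (U : R * R * R * R -> Prop) (k : nat) f :
  (forall p, U p -> 0 < f p) -> ck k U f -> ck k U (fun p => sqrt (f p)).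
Proof.
  intros hU.
  assert (hd : forall x, 0 < x -> is_derive sqrt x (/ (2 * sqrt x))).
  { intros x hx; auto_derive; [exact hx|].
    field; apply Rgt_not_eq, sqrt_lt_R0, hx. }
  induction k as [|k IH]; intros hf.
  - apply (ck_0_comp U _ sqrt _ f hd hU hf).
  - apply (ck_comp U _ sqrt _ k f hd hU hf).
    apply ck_inv.
    + intros p hp; pose proof (sqrt_lt_R0 _ (hU p hp)); lra.
    + apply ck_mult; [apply ck_const | apply IH, ck_pred, hf].
Qed.

Lemma ck_opp (U : R * R * R * R -> Prop) (k : nat) f :
  ck k U f -> ck k U (fun p => - f p).
Proof.
  intros hf; apply (ck_ext U k (fun p => -1 * f p)); [intros; ring|].
  apply ck_mult; [apply ck_const | exact hf].
Qed.

Lemma ck_minus (U : R * R * R * R -> Prop) (k : nat) f g :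
  ck k U f -> ck k U g -> ck k U (fun p => f p - g p).
Proof. intros hf hg; apply ck_plus; [exact hf | apply ck_opp, hg]. Qed.

Lemma ck_div (U : R * R * R * R -> Prop) (k : nat) f g :
  (forall p, U p -> g p <> 0) ->
  ck k U f -> ck k U g -> ck k U (fun p => f p / g p).
Proof. intros h hf hg; apply ck_mult; [exact hf | apply ck_inv; auto]. Qed.

Lemma ck_pow (U : R * R * R * R -> Prop) (k : nat) f (j : nat) :
  ck k U f -> ck k U (fun p => f p ^ j).
Proof.
  intros hf; induction j as [|j IH]; simpl;
    [apply ck_const | apply ck_mult; assumption].
Qed.

Ltac smoothness :=
  repeat match goal with
    | |- ck _ _ (fun _ => ?v) => apply ck_const
    | |- ck _ _ (fun p => fst (fst (fst p))) => apply ck_eps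
    | |- ck _ _ (fun p => snd (fst (fst p))) => apply ck_t
    | |- ck _ _ (fun p => snd (fst p)) => apply ck_S
    | |- ck _ _ snd => apply ck_C
    | |- ck _ _ (fun p => snd p) => apply ck_C
    | |- ck _ _ (fun p => _ + _) => apply ck_plus
    | |- ck _ _ (fun p => _ - _) => apply ck_minus
    | |- ck _ _ (fun p => _ * _) => apply ck_mult
    | |- ck _ _ (fun p => _ / _) => apply ck_div
    | |- ck _ _ (fun p => - _) => apply ck_opp
    | |- ck _ _ (fun p => _ ^ _) => apply ck_pow
    | |- ck _ _ (fun p => exp _) => apply ck_exp
    | |- ck _ _ (fun p => ln _) => apply ck_ln
    | |- ck _ _ (fun p => sqrt _) => apply ck_sqrt
    end.

(** [smooth] is stated with a tuple pattern; the closure lemmas work on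
    projections. *)
Lemma ck_action (U : R * R * R * R -> Prop) (k : nat)
    (h : R -> R -> R -> R -> R) :
  ck k U (fun p => h (fst (fst (fst p))) (snd (fst (fst p)))
                     (snd (fst p)) (snd p)) ->
  ck k U (fun p => let '(eps, t, s, c) := p in h eps t s c).
Proof. apply ck_ext; now intros [[[eps t] s] c]. Qed.

Lemma open_positive (h : R * R * R * R -> R) :
  ck 0 (fun _ => True) h -> open (fun p => 0 < h p).
Proof.
  intros [hc _]; apply (open_comp h (fun u => 0 < u)); [|apply open_gt].
  intros p _; apply hc, I.
Qed.

Lemma open_flow_domain (h : R -> R -> R) :
  ck 0 (fun _ => True) (fun p => h (fst (fst (fst p))) (snd (fst (fst p)))) ->
  open (fun p : R * R * R * R => let '(eps, t, s, _) := p in 0 < h eps t).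
Proof.
  intros hc; eapply open_ext; [|exact (open_positive _ hc)].
  now intros [[[eps t] s] c].
Qed.

Lemma G_smooth (r sigma : R) (i : group_index) :
  r <> 0 -> sigma <> 0 ->
  let U := fun p : R * R * R * R =>
    let '(eps, t, s, _) := p in dom (G r sigma i) eps (t, s) in
  open U /\
  smooth U (fun p => let '(eps, t, s, _) := p in act_t (G r sigma i) eps t s) /\
  smooth U (fun p => let '(eps, t, s, _) := p in act_S (G r sigma i) eps t s) /\
  smooth U (fun p => let '(eps, t, s, c) := p in act_C (G r sigma i) eps t s c).
Proof.
  intros hr hs U.
  assert (hs2 : sigma ^ 2 <> 0) by (apply pow_nonzero, hs).
  assert (hU4 : i = i4 -> forall p, U p ->
    0 < exp (2 * r * snd (fst (fst p))) + fst (fst (fst p)))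
    by (intros -> [[[eps t] s] c] hp; exact hp).
  assert (hU5 : i = i5 -> forall p, U p ->
    0 < exp (- 2 * r * snd (fst (fst p))) + fst (fst (fst p)))
    by (intros -> [[[eps t] s] c] hp; exact hp).
  splits.
  - unfold U; destruct i;
      try (apply (open_ext (fun _ => True));
           [intros [[[? ?] ?] ?]; now unfold dom | apply open_true]).
    + apply (open_flow_domain (fun eps t => exp (2 * r * t) + eps)); smoothness.
    + apply (open_flow_domain (fun eps t => exp (- 2 * r * t) + eps)); smoothness.
  - intros k; apply (ck_action U k (fun eps t s _ => act_t (G r sigma i) eps t s)).
    destruct i; simpl; smoothness; auto; intros; lra.
  - intros k; apply (ck_action U k (fun eps t s _ => act_S (G r sigma i) eps t s)).
    destruct i; simpl; smoothness; auto;
      intros p hp; apply Rgt_not_eq, sqrt_lt_R0; auto.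
  - intros k; apply (ck_action U k (act_C (G r sigma i))).
    destruct i; simpl act_C; smoothness; auto; intros p hp.
    + apply Rmult_integral_contrapositive_currified;
        [exact hs2 | apply Rgt_not_eq, hU4; auto].
    + apply Rgt_not_eq, sqrt_lt_R0, hU5; auto.
Qed.

(** * The six symmetry groups *)

Lemma sqrt_exp_ln (E : R) : 0 < E -> sqrt E = exp (ln E / 2).
Proof.
  intros hE; apply sqrt_lem_1; [lra | apply Rlt_le, exp_pos|].
  rewrite <- exp_plus; replace (ln E / 2 + ln E / 2) with (ln E) by field.
  apply exp_ln, hE.
Qed.

Lemma div_sqrt_exp (x E : R) : 0 < E -> exp x / sqrt E = exp (x - ln E / 2).
Proof.
  intros hE; unfold Rminus; rewrite exp_plus, exp_Ropp, sqrt_exp_ln by exact hE.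
  reflexivity.
Qed.

(** The logarithm of a multiplier relating the price to an invariant: for [mu = 0]
    and [mu = 1] dividing [C] by [exp weight] turns the equation into one
    without zeroth-order term, in which a motion of the underlying variables
    needs no multiplier.  Written with [mu] as a number so that both cases are
    handled by one formula. *)
Definition weight (r sigma mu t S : R) : R :=
  (1 + mu) * r * t - mu * r * S ^ 2 / sigma ^ 2.

(** For these two weights the determining equations reduce to the clock
    condition [tau' = alpha^2] and to equations which say that the substitution
    [alpha S + beta] carries the remaining drift [(1 - 2 mu) r S] to the same
    drift, run by the clock [tau].  The constant [k] accounts for constant multiples. *)
Lemma weighted_lie_system (r sigma mu k : R) (T : R -> Prop)
    (tau alpha beta : R -> R) :
  sigma <> 0 -> mu = 0 \/ mu = 1 -> open T ->
  (forall t, T t ->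
     is_derive tau t (alpha t ^ 2) /\
     is_derive alpha t ((1 - 2 * mu) * r * (alpha t * (alpha t ^ 2 - 1))) /\
     is_derive beta t ((1 - 2 * mu) * r * (alpha t ^ 2 * beta t))) ->
  lie_system r r sigma T tau alpha beta
    (fun t => (1 + mu) * r * (t - tau t) + mu * r * beta t ^ 2 / sigma ^ 2 - k)
    (fun t => 2 * mu * r * alpha t * beta t / sigma ^ 2)
    (fun t => mu * r * (alpha t ^ 2 - 1) / sigma ^ 2).
Proof.
  intros hs hmu oT H; split; [exact oT|].
  intros t ht; destruct (H t ht) as (h1 & h2 & h3).
  splits; [exact h1|..].
  1: evar_last; [exact h2|].
  2: evar_last; [exact h3|].
  3-5: auto_derive; [splits; eexists; eassumption|];
    rewrite ?(is_derive_unique (fun x : R => tau x) t _ h1),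
      ?(is_derive_unique (fun x : R => alpha x) t _ h2),
      ?(is_derive_unique (fun x : R => beta x) t _ h3).
  all: destruct hmu as [-> | ->]; field; exact hs.
Qed.

Definition group_mu (i : group_index) : R :=
  match i with i3 | i4 => 1 | _ => 0 end.

(** The scaling [i6] multiplies [C] by [exp eps] by definition; for the time
    translation [i1] the constant compensates the change of the weight. *)
Definition group_kappa (r : R) (i : group_index) : R :=
  match i with i1 => - r | i6 => 1 | _ => 0 end.

Section Groups.

Context (r sigma : R) (hr : r <> 0) (hsigma : sigma <> 0).

(** The multiplier of each group is, up to a character of the parameter, the
    coboundary of a function of [(t, S)].  The group law, linearity and
    positivity in [C] all follow from this form. *)
Lemma act_C_weight (i : group_index) (eps t S C : R) :
  dom (G r sigma i) eps (t, S) ->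
  act_C (G r sigma i) eps t S C
  = exp (weight r sigma (group_mu i)
           (act_t (G r sigma i) eps t S) (act_S (G r sigma i) eps t S)
         - weight r sigma (group_mu i) t S + group_kappa r i * eps) * C.
Proof.
  unfold weight; destruct i; simpl; intros hE.
  - match goal with |- _ = exp ?x * _ =>
      replace x with 0 by (field; exact hsigma) end.
    rewrite exp_0; ring.
  - match goal with |- _ = exp ?x * _ =>
      replace x with 0 by (field; exact hsigma) end.
    rewrite exp_0; ring.
  - do 2 f_equal; field; exact hsigma.
  - rewrite <- (exp_ln _ hE) at 3; rewrite <- exp_plus; do 2 f_equal.
    set (E := exp (2 * r * t) + eps) in *.
    (* the square of the new [S], where [exp (2 r t) = E - eps] *)
    replace (exp (r * t) * S / sqrt E * (exp (r * t) * S / sqrt E * 1))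
      with ((E - eps) * S ^ 2 / E); [field; splits; auto; lra|].
    replace (exp (r * t) * S / sqrt E * (exp (r * t) * S / sqrt E * 1))
      with (exp (r * t) * exp (r * t) * S ^ 2 / (sqrt E * sqrt E))
      by (field; pose proof (sqrt_lt_R0 _ hE); lra).
    rewrite sqrt_sqrt, <- exp_plus by lra; unfold E.
    replace (r * t + r * t) with (2 * r * t) by ring; field; fold E; lra.
  - set (E := exp (- 2 * r * t) + eps) in *.
    replace (exp (- r * t) * C / sqrt E) with (exp (- r * t) / sqrt E * C)
      by (unfold Rdiv; ring).
    pose proof (sqrt_lt_R0 _ hE); rewrite div_sqrt_exp by exact hE.
    do 2 f_equal; field; splits; auto; lra.
  - do 2 f_equal; field; exact hsigma.
Qed.

Lemma base_action_identity (i : group_index) (t S : R) :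
  dom (G r sigma i) 0 (t, S) /\
  act_t (G r sigma i) 0 t S = t /\ act_S (G r sigma i) 0 t S = S.
Proof.
  destruct i; simpl; splits; try exact I; try ring.
  - rewrite Rplus_0_r; apply exp_pos.
  - rewrite Rplus_0_r, ln_exp; field; exact hr.
  - rewrite Rplus_0_r, sqrt_exp_ln, ln_exp by apply exp_pos.
    replace (2 * r * t / 2) with (r * t) by field.
    pose proof (exp_pos (r * t)); field; lra.
  - rewrite Rplus_0_r; apply exp_pos.
  - rewrite Rplus_0_r, ln_exp; field; exact hr.
  - rewrite Rplus_0_r, sqrt_exp_ln, ln_exp by apply exp_pos.
    replace (- 2 * r * t / 2) with (- r * t) by field.
    pose proof (exp_pos (- r * t)); field; lra.
Qed.

Lemma base_action_inverse (i : group_index) (eps t S : R) :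
  dom (G r sigma i) eps (t, S) ->
  dom (G r sigma i) (- eps)
    (act_t (G r sigma i) eps t S, act_S (G r sigma i) eps t S).
Proof.
  destruct i; simpl; intros hE; try exact I.
  - replace (2 * r * (ln (exp (2 * r * t) + eps) / (2 * r)))
      with (ln (exp (2 * r * t) + eps)) by (field; exact hr).
    rewrite exp_ln by exact hE; pose proof (exp_pos (2 * r * t)); lra.
  - replace (- 2 * r * - (ln (exp (- 2 * r * t) + eps) / (2 * r)))
      with (ln (exp (- 2 * r * t) + eps)) by (field; exact hr).
    rewrite exp_ln by exact hE; pose proof (exp_pos (- 2 * r * t)); lra.
Qed.

Lemma base_action_composition (i : group_index) (eps delta t S : R) :
  let t' := act_t (G r sigma i) eps t S in
  let S' := act_S (G r sigma i) eps t S in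
  dom (G r sigma i) eps (t, S) -> dom (G r sigma i) delta (t', S') ->
  dom (G r sigma i) (eps + delta) (t, S) /\
  act_t (G r sigma i) delta t' S' = act_t (G r sigma i) (eps + delta) t S /\
  act_S (G r sigma i) delta t' S' = act_S (G r sigma i) (eps + delta) t S.
Proof.
  destruct i; simpl.
  - intros _ _; splits; [exact I | ring | ring].
  - intros _ _; splits; [exact I | ring | ring].
  - intros _ _; splits; [exact I | ring | ring].
  - set (E := exp (2 * r * t) + eps); intros hE.
    replace (2 * r * (ln E / (2 * r))) with (ln E) by (field; exact hr).
    replace (r * (ln E / (2 * r))) with (ln E / 2) by (field; exact hr).
    rewrite exp_ln, <- sqrt_exp_ln by exact hE; intros hE2.
    replace (exp (2 * r * t) + (eps + delta)) with (E + delta)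
      by (unfold E; ring).
    splits; [exact hE2 | reflexivity|].
    pose proof (sqrt_lt_R0 _ hE); pose proof (sqrt_lt_R0 _ hE2); field; lra.
  - set (E := exp (- 2 * r * t) + eps); intros hE.
    replace (- 2 * r * - (ln E / (2 * r))) with (ln E) by (field; exact hr).
    replace (- r * - (ln E / (2 * r))) with (ln E / 2) by (field; exact hr).
    rewrite exp_ln, <- sqrt_exp_ln by exact hE; intros hE2.
    replace (exp (- 2 * r * t) + (eps + delta)) with (E + delta)
      by (unfold E; ring).
    splits; [exact hE2 | reflexivity|].
    pose proof (sqrt_lt_R0 _ hE); pose proof (sqrt_lt_R0 _ hE2); field; lra.
  - intros _ _; splits; [exact I | ring | ring].
Qed.

Lemma G_one_parameter_group (i : group_index) :
  one_parameter_group (G r sigma i).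
Proof.
  destruct (G_smooth r sigma i hr hsigma) as (h1 & h2 & h3 & h4).
  unfold one_parameter_group; splits; try assumption.
  - intros t S C; destruct (base_action_identity i t S) as (h & ht & hS).
    splits; try assumption.
    rewrite act_C_weight, ht, hS by exact h.
    match goal with |- exp ?x * _ = _ => replace x with 0 by ring end.
    rewrite exp_0; ring.
  - apply base_action_inverse.
  - cbv zeta; intros eps delta t S C he hd.
    destruct (base_action_composition i eps delta t S he hd) as (h & ht & hS).
    splits; try assumption.
    rewrite !act_C_weight by assumption.
    rewrite ht, hS, <- Rmult_assoc, <- exp_plus; do 2 f_equal; ring.
Qed.

Lemma act_C_linear (i : group_index) (eps t S : R) :
  dom (G r sigma i) eps (t, S) ->
  0 < act_C (G r sigma i) eps t S 1 /\
  forall C, act_C (G r sigma i) eps t S C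
            = act_C (G r sigma i) eps t S 1 * C.
Proof.
  intros h; rewrite act_C_weight, Rmult_1_r by exact h.
  split; [apply exp_pos|].
  intros C; apply act_C_weight, h.
Qed.

(** Each group acts on [t] alone and on [S] by affine maps with coefficients
    depending on [t], as the change of variables requires. *)
Lemma base_action_affine (i : group_index) (eps : R) :
  exists (T : R -> Prop) (tau alpha beta : R -> R),
    open T /\
    (forall t S, dom (G r sigma i) eps (t, S) <-> T t) /\
    (forall t, T t ->
       is_derive tau t (alpha t ^ 2) /\
       is_derive alpha t
         ((1 - 2 * group_mu i) * r * (alpha t * (alpha t ^ 2 - 1))) /\
       is_derive beta t
         ((1 - 2 * group_mu i) * r * (alpha t ^ 2 * beta t))) /\
    (forall t S, T t ->
       act_t (G r sigma i) eps t S = tau t /\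
       act_S (G r sigma i) eps t S = alpha t * S + beta t).
Proof.
  assert (hopen : forall h : R -> R, (forall t, ex_derive h t) ->
    open (fun t => 0 < h t)).
  { intros h hd; apply (open_comp h (fun u => 0 < u)); [|apply open_gt].
    intros t _; apply (ex_derive_continuous (V := R_NormedModule)), hd. }
  destruct i; cbn [G dom act_t act_S group_mu fst snd]; unfold whole_plane.
  - exists (fun _ => True), (fun t => t + eps), (fun _ => 1), (fun _ => 0).
    splits; [apply open_true | now split | |].
    + intros t _; splits; auto_derive; auto; ring.
    + intros; split; ring.
  - exists (fun _ => True), (fun t => t), (fun _ => 1),
      (fun t => eps * exp (r * t)).
    splits; [apply open_true | now split | |].
    + intros t _; splits; auto_derive; auto; ring.
    + intros; split; ring.
  - exists (fun _ => True), (fun t => t), (fun _ => 1),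
      (fun t => eps * exp (- r * t)).
    splits; [apply open_true | now split | |].
    + intros t _; splits; auto_derive; auto; ring.
    + intros; split; ring.
  - exists (fun t => 0 < exp (2 * r * t) + eps),
      (fun t => ln (exp (2 * r * t) + eps) / (2 * r)),
      (fun t => exp (r * t - ln (exp (2 * r * t) + eps) / 2)), (fun _ => 0).
    splits.
    + apply hopen; intros t; auto_derive; exact I.
    + now split.
    + intros t ht; set (E := exp (2 * r * t) + eps) in *.
      assert (ha : exp (r * t - ln E / 2) ^ 2 = exp (2 * r * t) / E).
      { simpl; rewrite Rmult_1_r, <- exp_plus.
        replace (r * t - ln E / 2 + (r * t - ln E / 2))
          with (2 * r * t + - ln E) by field.
        rewrite exp_plus, exp_Ropp, exp_ln by exact ht; reflexivity. }
      rewrite ha; splits; auto_derive; auto; fold E;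
        try (unfold Rminus, Rdiv; field; splits; auto; lra).
    + intros t S ht; split; [reflexivity|].
      rewrite <- div_sqrt_exp by exact ht; unfold Rdiv; ring.
  - exists (fun t => 0 < exp (- 2 * r * t) + eps),
      (fun t => - (ln (exp (- 2 * r * t) + eps) / (2 * r))),
      (fun t => exp (- r * t - ln (exp (- 2 * r * t) + eps) / 2)), (fun _ => 0).
    splits.
    + apply hopen; intros t; auto_derive; exact I.
    + now split.
    + intros t ht; set (E := exp (- 2 * r * t) + eps) in *.
      assert (ha : exp (- r * t - ln E / 2) ^ 2 = exp (- 2 * r * t) / E).
      { simpl; rewrite Rmult_1_r, <- exp_plus.
        replace (- r * t - ln E / 2 + (- r * t - ln E / 2))
          with (- 2 * r * t + - ln E) by field.
        rewrite exp_plus, exp_Ropp, exp_ln by exact ht; reflexivity. }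
      rewrite ha; splits; auto_derive; auto; fold E;
        try (unfold Rminus, Rdiv; field; splits; auto; lra).
    + intros t S ht; split; [reflexivity|].
      rewrite <- div_sqrt_exp by exact ht; unfold Rdiv; ring.
  - exists (fun _ => True), (fun t => t), (fun _ => 1), (fun _ => 0).
    splits; [apply open_true | now split | |].
    + intros t _; splits; auto_derive; auto; ring.
    + intros; split; ring.
Qed.

Lemma transformed_bachelier (i : group_index) (eps : R) (D : R * R -> Prop)
    (f : R -> R -> R) :
  bachelier_solution r sigma D f ->
  bachelier_solution r sigma (transformed_domain (G r sigma i) eps D)
    (fun t S => f (act_t (G r sigma i) eps t S) (act_S (G r sigma i) eps t S)
                / act_C (G r sigma i) eps t S 1).
Proof.
  intros hf.
  destruct (base_action_affine i eps)
    as (T & tau & alpha & beta & oT & hdom & hode & hact).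
  assert (hmu : group_mu i = 0 \/ group_mu i = 1) by (destruct i; simpl; lra).
  refine (bachelier_ext r sigma _ _ _ _ _ _
    (bachelier_change_of_variables _ _ _ _ _ _ _ _ _ _ _ _
      (weighted_lie_system r sigma _ (group_kappa r i * eps) T tau alpha beta
         hsigma hmu oT hode) hf)).
  - intros [t S]; unfold transformed_domain; simpl fst; simpl snd.
    rewrite hdom; split; intros [ht hD];
      destruct (hact t S ht) as [e1 e2];
      [rewrite e1, e2 | rewrite <- e1, <- e2]; auto.
  - intros t S [ht _]; simpl in ht; destruct (hact t S ht) as [e1 e2].
    rewrite act_C_weight by (apply hdom, ht).
    rewrite e1, e2, Rmult_1_r; unfold Rdiv; rewrite <- exp_Ropp.
    rewrite Rmult_comm; f_equal; f_equal; unfold weight; field; exact hsigma.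
Qed.

Lemma transformed_determines (i : group_index) (eps : R) (D : R * R -> Prop)
    (P : R -> R -> R -> R) (f : R -> R -> R) :
  determines D P f ->
  determines (transformed_domain (G r sigma i) eps D)
    (transformed (G r sigma i) eps P)
    (fun t S => f (act_t (G r sigma i) eps t S) (act_S (G r sigma i) eps t S)
                / act_C (G r sigma i) eps t S 1).
Proof.
  intros hf t S C [hd hD]; simpl in hD.
  destruct (act_C_linear i eps t S hd) as [hpos hlin].
  unfold transformed; rewrite (hf _ _ _ hD), hlin.
  split; intros h; [rewrite <- h | rewrite h]; field; lra.
Qed.

Lemma G_point_symmetry_group (i : group_index) :
  point_symmetry_group r sigma (G r sigma i).
Proof.
  split; [apply G_one_parameter_group|].
  intros eps D P (f & hdet & hf); eexists; split.
  - apply transformed_determines, hdet.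
  - apply transformed_bachelier, hf.
Qed.

End Groups.

(** * Elementary solutions *)

Lemma elementary_opp D f :
  elementary D f -> elementary D (fun t S => - f t S).
Proof.
  intros hf; apply (elementary_ext D (fun t S => 0 - f t S)).
  - apply elementary_minus; [apply elementary_const | exact hf].
  - intros; ring.
Qed.

Lemma elementary_pow D f (j : nat) :
  elementary D f -> elementary D (fun t S => f t S ^ j).
Proof.
  intros hf; induction j as [|j IH]; simpl;
    [apply elementary_const | apply elementary_mult; assumption].
Qed.

Lemma elementary_kummer D (m : nat) (q : R) f :
  elementary D f -> elementary D (fun t S => kummer (- INR m) q (f t S)).
Proof.
  intros hf.
  apply (elementary_ext D (fun t S => kummer_sum (- INR m) q m (f t S)));
    [|intros; symmetry; apply kummer_terminates].
  unfold kummer_sum.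
  generalize m at 2 as N; induction N as [|N IH]; simpl sum_f_R0.
  - apply elementary_mult; apply elementary_const.
  - apply elementary_plus; [exact IH|].
    apply elementary_mult; [apply elementary_const|].
    apply (elementary_pow D f (S N) hf).
Qed.

Ltac elementarity :=
  repeat match goal with
    | |- elementary _ (fun t S => ?v) => apply elementary_const
    | |- elementary _ (fun t S => t) => apply elementary_t
    | |- elementary _ (fun t S => S) => apply elementary_S
    | |- elementary _ (fun t S => _ + _) => apply elementary_plus
    | |- elementary _ (fun t S => _ - _) => apply elementary_minus
    | |- elementary _ (fun t S => _ * _) => apply elementary_mult
    | |- elementary _ (fun t S => _ / _) => apply elementary_div
    | |- elementary _ (fun t S => - _) => apply elementary_opp
    | |- elementary _ (fun t S => _ ^ _) => apply elementary_pow
    | |- elementary _ (fun t S => exp _) => apply elementary_exp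
    | |- elementary _ (fun t S => ln _) => apply elementary_ln
    | |- elementary _ (fun t S => sqrt _) => apply elementary_sqrt
    | |- elementary _ (fun t S => kummer _ _ _) => apply elementary_kummer
    | |- elementary _ _ => assumption
    end.

Lemma elementary_C_fun (r sigma : R) (q : solution_index) (n : Z) D f g :
  sigma <> 0 -> admissible n -> elementary D f -> elementary D g ->
  elementary D (fun t S => C_fun r sigma q n (f t S) (g t S)).
Proof.
  intros hs hn hf hg; destruct (index_half n hn) as (m & _ & hm).
  unfold C_fun; rewrite hm; destruct q; elementarity; auto.
Qed.

Section Classes.

Context (r sigma : R) (hr : r <> 0) (hsigma : sigma <> 0).

Lemma elementary_action (i : group_index) (eps : R) :
  let D := dom (G r sigma i) eps in
  elementary D (act_t (G r sigma i) eps) /\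
  elementary D (act_S (G r sigma i) eps) /\
  elementary D (fun t S => act_C (G r sigma i) eps t S 1).
Proof.
  assert (hs2 : sigma ^ 2 <> 0) by (apply pow_nonzero, hsigma).
  assert (hr2 : 2 * r <> 0) by lra.
  assert (hsqrt : forall x, 0 < x -> sqrt x <> 0)
    by (intros x hx; apply Rgt_not_eq, sqrt_lt_R0, hx).
  destruct i; cbn [G dom act_t act_S act_C]; splits; elementarity; auto.
  intros t S h; apply Rmult_integral_contrapositive_currified;
    [exact hs2 | apply Rgt_not_eq, h].
Qed.

Definition transformed_price (q : solution_index) (i : group_index) (n : Z)
    (eps t S : R) : R :=
  C_fun r sigma q n (act_t (G r sigma i) eps t S) (act_S (G r sigma i) eps t S)
  / act_C (G r sigma i) eps t S 1.

Lemma Phi_determines (q : solution_index) (n : Z) :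
  determines whole_plane (Phi r sigma q n) (C_fun r sigma q n).
Proof. intros t S C _; unfold Phi; split; lra. Qed.

Lemma Phi_elementary_solution (q : solution_index) (n : Z) : admissible n ->
  elementary_solution r sigma whole_plane (Phi r sigma q n).
Proof.
  intros hn; exists (C_fun r sigma q n); splits.
  - apply Phi_determines.
  - apply C_fun_solution; assumption.
  - apply (elementary_C_fun r sigma q n _ (fun t _ => t) (fun _ S => S));
      auto; [apply elementary_t | apply elementary_S].
Qed.

Lemma transformed_Phi_determines (q : solution_index) (i : group_index)
    (n : Z) (eps : R) :
  determines (dom (G r sigma i) eps)
    (transformed (G r sigma i) eps (Phi r sigma q n))
    (transformed_price q i n eps).
Proof.
  intros t S C h.
  apply (transformed_determines r sigma hr hsigma i eps whole_plane);
    [apply Phi_determines | split; [exact h | exact I]].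
Qed.

Lemma transformed_Phi_elementary_solution (q : solution_index)
    (i : group_index) (n : Z) (eps : R) : admissible n ->
  elementary_solution r sigma (dom (G r sigma i) eps)
    (transformed (G r sigma i) eps (Phi r sigma q n)).
Proof.
  intros hn; exists (transformed_price q i n eps); splits.
  - apply transformed_Phi_determines.
  - refine (bachelier_ext r sigma _ _ _ _ _ _
      (transformed_bachelier r sigma hr hsigma i eps whole_plane _
        (C_fun_solution r sigma q n hsigma hn))).
    + intros p; unfold transformed_domain, whole_plane; tauto.
    + reflexivity.
  - destruct (elementary_action i eps) as (h1 & h2 & h3).
    apply elementary_div; [apply elementary_C_fun; assumption | exact h3|].
    intros t S h; destruct (act_C_linear r sigma hr hsigma i eps t S h); lra.
Qed.

(** * Distinct families and classes *)

(** The exponent of [exp (r t)] in the solution; for even [n <= 0] its parity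
    and its size determine both [q] and [n]. *)
Definition growth_rate (q : solution_index) (n : Z) : Z :=
  match q with
  | q1 => n
  | q2 => n + 1
  | q3 => 3 - n
  | q4 => 2 - n
  end.

Lemma C_fun_separated (q : solution_index) (n : Z) (t S : R) :
  C_fun r sigma q n t S
  = C_fun r sigma q n 0 S * exp (IZR (growth_rate q n) * r * t).
Proof.
  destruct q; unfold C_fun, growth_rate; rewrite ?Rmult_0_r, exp_0, Rmult_1_r;
    try reflexivity; f_equal; f_equal; rewrite ?plus_IZR, ?minus_IZR; ring.
Qed.

Lemma growth_rate_injective (q q' : solution_index) (n n' : Z) :
  admissible n -> admissible n' ->
  growth_rate q n = growth_rate q' n' -> q = q' /\ n = n'.
Proof.
  intros [h [k hk]] [h' [k' hk']].
  destruct q, q'; cbn [growth_rate]; intros e;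
    solve [split; [reflexivity | lia] | exfalso; lia].
Qed.

Lemma C_fun_nonzero (q : solution_index) (n : Z) : admissible n ->
  exists S, C_fun r sigma q n 0 S <> 0.
Proof.
  intros hn; destruct (index_half n hn) as (m & _ & hm).
  assert (hK : forall b k, 0 < b ->
    exists S, 0 < S /\ 0 < kummer (- INR m) b (k * (S / sigma) ^ 2)).
  { intros b k hb.
    destruct (kummer_polynomial m b hb) as (K1 & _ & hK & _).
    assert (hc : continuous (fun S => kummer (- INR m) b (k * (S / sigma) ^ 2)) 0).
    { apply (ex_derive_continuous (V := R_NormedModule)).
      auto_derive; eexists; apply hK. }
    destruct (hc (fun y => 0 < y)) as [e he].
    - apply (open_gt 0).
      replace (k * (0 / sigma) ^ 2) with 0 by (field; exact hsigma).
      rewrite kummer_at_0; lra.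
    - pose proof (cond_pos e); exists (e / 2); split; [lra|].
      apply (he (e / 2)).
      change (Rabs (e / 2 - 0) < e); rewrite Rabs_pos_eq; lra. }
  unfold C_fun; rewrite hm.
  destruct q;
    [ destruct (hK (3 / 2) (- r) ltac:(lra)) as (S & hS & h)
    | destruct (hK (1 / 2) (- r) ltac:(lra)) as (S & hS & h)
    | destruct (hK (3 / 2) r ltac:(lra)) as (S & hS & h)
    | destruct (hK (1 / 2) r ltac:(lra)) as (S & hS & h) ];
    exists S; rewrite ?Ropp_mult_distr_l in *;
    repeat apply Rmult_integral_contrapositive_currified;
    apply not_eq_sym, Rlt_not_eq; auto using exp_pos.
Qed.

(** The value at [t = 1 / r] relative to [t = 0] is the exponential of the
    growth rate, provided that the initial value does not vanish. *)
Lemma C_fun_injective (q q' : solution_index) (n n' : Z) :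
  admissible n -> admissible n' ->
  (forall t S, C_fun r sigma q n t S = C_fun r sigma q' n' t S) ->
  q = q' /\ n = n'.
Proof.
  intros hn hn' h; apply growth_rate_injective; auto.
  destruct (C_fun_nonzero q n hn) as [S hS].
  pose proof (h (/ r) S) as h1; rewrite C_fun_separated in h1.
  rewrite (C_fun_separated q' n'), <- h in h1.
  apply Rmult_eq_reg_l in h1; [|exact hS].
  apply exp_inv in h1; apply eq_IZR.
  apply (Rmult_eq_reg_r (r * / r)); [lra|].
  rewrite Rinv_r by exact hr; lra.
Qed.

Lemma mapped_family_price (q : solution_index) (i : group_index) (n : Z)
    (eps t S C : R) :
  mapped_family r sigma q i n eps t S C <->
  dom (G r sigma i) eps (t, S) /\ C = transformed_price q i n eps t S.
Proof.
  unfold mapped_family; split; intros [hd h]; (split; [exact hd|]);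
    apply (transformed_Phi_determines q i n eps t S C hd), h.
Qed.

Lemma mapped_family_eq (q q' : solution_index) (i i' : group_index)
    (n n' : Z) :
  mapped_family r sigma q i n = mapped_family r sigma q' i' n' ->
  forall eps t S,
    (dom (G r sigma i) eps (t, S) <-> dom (G r sigma i') eps (t, S)) /\
    (dom (G r sigma i) eps (t, S) ->
     transformed_price q i n eps t S = transformed_price q' i' n' eps t S).
Proof.
  intros e eps t S.
  assert (h : forall C,
    dom (G r sigma i) eps (t, S) /\ C = transformed_price q i n eps t S <->
    dom (G r sigma i') eps (t, S) /\ C = transformed_price q' i' n' eps t S)
    by (intros C; rewrite <- !mapped_family_price, e; reflexivity).
  splits.
  - split; intros hd; eapply h; split; eauto.
  - intros hd; apply (h (transformed_price q i n eps t S)); auto.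
Qed.

Lemma transformed_price_0 (q : solution_index) (i : group_index) (n : Z)
    (t S : R) :
  transformed_price q i n 0 t S = C_fun r sigma q n t S.
Proof.
  destruct (G_one_parameter_group r sigma hr hsigma i)
    as (_ & _ & _ & _ & h & _).
  destruct (h t S 1) as (_ & h1 & h2 & h3).
  unfold transformed_price; rewrite h1, h2, h3; field.
Qed.

(** At parameter 0 every family contains the solution it was made from. *)
Lemma mapped_family_injective (q q' : solution_index) (i i' : group_index)
    (n n' : Z) :
  admissible n -> admissible n' ->
  mapped_family r sigma q i n = mapped_family r sigma q' i' n' ->
  q = q' /\ n = n'.
Proof.
  intros hn hn' e; apply C_fun_injective; auto; intros t S.
  rewrite <- (transformed_price_0 q i), <- (transformed_price_0 q' i').
  apply (mapped_family_eq _ _ _ _ _ _ e); apply base_action_identity, hr.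
Qed.

Lemma admissible_even (m : nat) : admissible (-2 * Z.of_nat m).
Proof. split; [lia | exists (- Z.of_nat m)%Z; lia]. Qed.

Lemma family_class_enumeration (q : solution_index) (i : group_index) :
  enumerates (fun m : nat => mapped_family r sigma q i (-2 * Z.of_nat m)%Z)
    (family_class r sigma q i).
Proof.
  split.
  - intros m m' e.
    apply mapped_family_injective in e; try apply admissible_even; lia.
  - intros Fam; split.
    + intros (n & hn & ->); destruct (index_half n hn) as (m & -> & _).
      now exists m.
    + intros [m ->]; eexists; split; [apply admissible_even | reflexivity].
Qed.

Lemma C_fun_0_0 (q : solution_index) (S : R) :
  C_fun r sigma q 0 0 S
  = match q with
    | q1 => S
    | q2 => 1
    | q3 => exp (- (r * (S / sigma) ^ 2)) * S
    | q4 => exp (- (r * (S / sigma) ^ 2))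
    end.
Proof.
  assert (hK : forall b u, kummer (0 / 2) b u = 1).
  { intros b u; replace (0 / 2) with (- INR 0) by (simpl; field).
    rewrite kummer_terminates; unfold kummer_sum, kummer_coef; simpl; field. }
  unfold C_fun; destruct q; rewrite hK, Rmult_0_r, exp_0; ring.
Qed.

Lemma r_over_sigma2_neq_0 : r / sigma ^ 2 <> 0.
Proof.
  apply Rmult_integral_contrapositive_currified;
    [exact hr | apply Rinv_neq_0_compat, pow_nonzero, hsigma].
Qed.

(** Of the four initial values for [n = 0], only the constant one is multiplied
    by a factor when [S] is translated; it is the degenerate case of [i2]. *)
Lemma C_fun_0_translation (q : solution_index) (c : R) :
  (forall S, exp c * C_fun r sigma q 0 0 S = C_fun r sigma q 0 0 (S + 1)) ->
  q = q2 /\ c = 0.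
Proof.
  intros h; pose proof (h 0) as h0; pose proof (h (-1)) as h1.
  pose proof r_over_sigma2_neq_0 as hz.
  destruct q; rewrite !C_fun_0_0 in h0, h1.
  - exfalso; lra.
  - split; [reflexivity|]; apply exp_inv; rewrite exp_0; lra.
  - exfalso; pose proof (exp_pos (- (r * ((0 + 1) / sigma) ^ 2))); lra.
  - exfalso; apply hz.
    rewrite <- exp_plus in h0, h1; apply exp_inv in h0, h1.
    replace (r / sigma ^ 2) with (r * ((0 + 1) / sigma) ^ 2)
      by (field; exact hsigma).
    replace (r * ((-1) / sigma) ^ 2) with (r * ((0 + 1) / sigma) ^ 2) in h1
      by (field; exact hsigma).
    replace (r * ((-1 + 1) / sigma) ^ 2) with 0 in h1 by (field; exact hsigma).
    replace (r * (0 / sigma) ^ 2) with 0 in h0 by (field; exact hsigma).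
    lra.
Qed.

(** With the Gaussian multiplier of [i3] added to the translation, it is the
    Gaussian [exp (- r S^2 / sigma^2)] that plays the part of the constant. *)
Lemma C_fun_0_weighted_translation (q : solution_index) (c : R) :
  (forall S, exp c * C_fun r sigma q 0 0 S
     = exp (r / sigma ^ 2 * (1 + 2 * S)) * C_fun r sigma q 0 0 (S + 1)) ->
  q = q4 /\ c = 0.
Proof.
  intros h; pose proof (h 0) as h0; pose proof (h (-1)) as h1.
  pose proof r_over_sigma2_neq_0 as hz.
  destruct q; rewrite !C_fun_0_0 in h0, h1.
  - exfalso; pose proof (exp_pos (r / sigma ^ 2 * (1 + 2 * 0))); lra.
  - exfalso; apply hz; rewrite !Rmult_1_r in h0, h1.
    apply exp_inv in h0, h1; lra.
  - exfalso; rewrite <- Rmult_assoc, <- exp_plus in h0.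
    pose proof (exp_pos (r / sigma ^ 2 * (1 + 2 * 0)
      + - (r * ((0 + 1) / sigma) ^ 2))).
    rewrite <- Rmult_assoc, <- exp_plus in h0; lra.
  - split; [reflexivity|].
    rewrite <- !exp_plus in h0; apply exp_inv in h0.
    replace (r * ((0 + 1) / sigma) ^ 2) with (r / sigma ^ 2) in h0
      by (field; exact hsigma).
    replace (r * (0 / sigma) ^ 2) with 0 in h0 by (field; exact hsigma).
    lra.
Qed.

Lemma transformed_price_1 (q : solution_index) (n : Z) (S : R) :
  transformed_price q i1 n 1 0 S
    = exp (IZR (growth_rate q n) * r) * C_fun r sigma q n 0 S /\
  transformed_price q i2 n 1 0 S = C_fun r sigma q n 0 (S + 1) /\
  transformed_price q i3 n 1 0 S
    = exp (r / sigma ^ 2 * (1 + 2 * S)) * C_fun r sigma q n 0 (S + 1) /\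
  transformed_price q i6 n 1 0 S = exp (-1) * C_fun r sigma q n 0 S.
Proof.
  unfold transformed_price; cbn [G act_t act_S act_C].
  rewrite !Rmult_0_r, exp_0, !Rmult_1_r, !Rmult_1_l, Rplus_0_l.
  unfold Rdiv at 1 2; rewrite Rinv_1, !Rmult_1_r; splits.
  - rewrite C_fun_separated, Rmult_1_r; apply Rmult_comm.
  - reflexivity.
  - unfold Rdiv at 1; rewrite <- exp_Ropp, Rmult_comm; do 2 f_equal.
    field; exact hsigma.
  - unfold Rdiv; rewrite <- exp_Ropp; apply Rmult_comm.
Qed.

(** Time translation and scaling multiply the initial value by a constant, which
    the two translations of [S] do, for [n = 0], only in their degenerate cases,
    and then with the constant 1.  The two translations of [S] differ by a
    nontrivial multiplier.  Time translation may agree with scaling for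
    one [n], but the growth rates for [n = 0] and [n = -2] differ. *)
Lemma whole_plane_groups_separated (q : solution_index) (i i' : group_index) :
  In i (i1 :: i2 :: i3 :: i6 :: nil) -> In i' (i1 :: i2 :: i3 :: i6 :: nil) ->
  (forall n S, admissible n ->
     transformed_price q i n 1 0 S = transformed_price q i' n 1 0 S) ->
  i = i'.
Proof.
  assert (adm0 : admissible 0) by apply (admissible_even 0).
  assert (adm2 : admissible (-2)) by apply (admissible_even 1).
  assert (h12 : ~ forall n S, admissible n ->
    transformed_price q i1 n 1 0 S = transformed_price q i2 n 1 0 S).
  { intros h; destruct (C_fun_0_translation q (IZR (growth_rate q 0) * r))
      as [-> hc]; [|simpl in hc; lra].
    intros S; destruct (transformed_price_1 q 0 S) as (e1 & e2 & e3 & e6).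
    rewrite <- e1, <- e2; apply h, adm0. }
  assert (h13 : ~ forall n S, admissible n ->
    transformed_price q i1 n 1 0 S = transformed_price q i3 n 1 0 S).
  { intros h; destruct (C_fun_0_weighted_translation q
      (IZR (growth_rate q 0) * r)) as [-> hc]; [|simpl in hc; lra].
    intros S; destruct (transformed_price_1 q 0 S) as (e1 & e2 & e3 & e6).
    rewrite <- e1, <- e3; apply h, adm0. }
  assert (h62 : ~ forall n S, admissible n ->
    transformed_price q i6 n 1 0 S = transformed_price q i2 n 1 0 S).
  { intros h; destruct (C_fun_0_translation q (-1)) as [_ hc]; [|lra].
    intros S; destruct (transformed_price_1 q 0 S) as (e1 & e2 & e3 & e6).
    rewrite <- e6, <- e2; apply h, adm0. }
  assert (h63 : ~ forall n S, admissible n ->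
    transformed_price q i6 n 1 0 S = transformed_price q i3 n 1 0 S).
  { intros h; destruct (C_fun_0_weighted_translation q (-1)) as [_ hc];
      [|lra].
    intros S; destruct (transformed_price_1 q 0 S) as (e1 & e2 & e3 & e6).
    rewrite <- e6, <- e3; apply h, adm0. }
  assert (h23 : ~ forall n S, admissible n ->
    transformed_price q i2 n 1 0 S = transformed_price q i3 n 1 0 S).
  { intros h; pose proof (h 0%Z 0 adm0) as h0.
    destruct (transformed_price_1 q 0 0) as (e1 & e2 & e3 & e6).
    rewrite e2, e3 in h0; apply r_over_sigma2_neq_0, exp_inv.
    apply (Rmult_eq_reg_r (C_fun r sigma q 0 0 (0 + 1))).
    - replace (r / sigma ^ 2) with (r / sigma ^ 2 * (1 + 2 * 0)) by ring.
      rewrite <- h0, exp_0; ring.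
    - rewrite C_fun_0_0; destruct q;
        try pose proof (exp_pos (- (r * ((0 + 1) / sigma) ^ 2))); lra. }
  assert (h16 : ~ forall n S, admissible n ->
    transformed_price q i1 n 1 0 S = transformed_price q i6 n 1 0 S).
  { intros h.
    assert (hc : forall n, admissible n -> IZR (growth_rate q n) * r = -1).
    { intros n hn; destruct (C_fun_nonzero q n hn) as [S hS].
      destruct (transformed_price_1 q n S) as (e1 & e2 & e3 & e6).
      apply exp_inv, (Rmult_eq_reg_r (C_fun r sigma q n 0 S)); [|exact hS].
      rewrite <- e1, <- e6; apply h, hn. }
    pose proof (hc _ adm0) as c0; pose proof (hc _ adm2) as c2.
    rewrite <- c2 in c0; apply Rmult_eq_reg_r in c0; [|exact hr].
    apply eq_IZR, growth_rate_injective in c0; auto; lia. }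
  assert (sym : forall j j', (forall n S, admissible n ->
      transformed_price q j n 1 0 S = transformed_price q j' n 1 0 S) ->
    forall n S, admissible n ->
      transformed_price q j' n 1 0 S = transformed_price q j n 1 0 S)
    by (intros j j' h n S hn; symmetry; apply h, hn).
  simpl; intros hi hi' h; pose proof (sym _ _ h) as h'.
  destruct i, i'; try reflexivity; exfalso; tauto || intuition discriminate.
Qed.

(** For a negative parameter the points where [i4] and [i5] are considered form
    a half-plane bounded by a line [t = const], on opposite sides for the two
    groups; parameter -1 and the times 0 and [1 / r] detect it. *)
Lemma group_domains_separated (i i' : group_index) :
  (forall eps t S, dom (G r sigma i) eps (t, S) <->
                   dom (G r sigma i') eps (t, S)) ->
  i = i' \/
  In i (i1 :: i2 :: i3 :: i6 :: nil) /\ In i' (i1 :: i2 :: i3 :: i6 :: nil).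
Proof.
  intros h.
  pose proof (h (-1) 0 0) as h0; pose proof (h (-1) (/ r) 0) as h1.
  destruct i, i'; cbn [G dom fst] in h0, h1; unfold whole_plane in h0, h1;
    try (left; reflexivity); try (right; simpl; tauto);
    exfalso; rewrite ?Rmult_0_r, ?exp_0 in h0;
    try (destruct h0 as [h0 h0']; first
           [ specialize (h0 I); lra | specialize (h0' I); lra ]).
  all: replace (2 * r * / r) with 2 in h1 by (field; exact hr);
    replace (- 2 * r * / r) with (- 2) in h1 by (field; exact hr);
    pose proof (exp_increasing 0 2 ltac:(lra)) as e2;
    pose proof (exp_increasing (- 2) 0 ltac:(lra)) as e2';
    rewrite exp_0 in e2, e2'; lra.
Qed.

Lemma group_index_separated (q : solution_index) (i i' : group_index) :
  (forall n, admissible n ->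
     mapped_family r sigma q i n = mapped_family r sigma q i' n) ->
  i = i'.
Proof.
  intros h.
  pose proof (fun n hn => mapped_family_eq _ _ _ _ _ _ (h n hn)) as H.
  destruct (group_domains_separated i i') as [hi | [hi hi']]; [|exact hi|].
  - intros eps t S; apply (H 0%Z (admissible_even 0)).
  - apply (whole_plane_groups_separated q i i' hi hi').
    intros n S hn; apply (H n hn 1 0 S).
    destruct i; try exact I; simpl in hi; intuition discriminate.
Qed.

(** Parameter 0 of a common family gives [q] and [n]; hence equal classes have
    the same family for each [n], and the groups can be compared. *)
Lemma family_class_injective (q q' : solution_index) (i i' : group_index) :
  family_class r sigma q i = family_class r sigma q' i' -> q = q' /\ i = i'.
Proof.
  intros e.
  assert (h : forall n, admissible n -> q = q' /\
    mapped_family r sigma q i n = mapped_family r sigma q' i' n).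
  { intros n hn.
    assert (hc : family_class r sigma q' i' (mapped_family r sigma q i n))
      by (rewrite <- e; now exists n).
    destruct hc as (n' & hn' & hc).
    destruct (mapped_family_injective _ _ _ _ _ _ hn hn' hc) as [hq ->].
    auto. }
  destruct (h 0%Z (admissible_even 0)) as [<- _]; split; [reflexivity|].
  apply (group_index_separated q); intros n hn; apply h, hn.
Qed.

Lemma family_class_cardinal :
  has_cardinal (fun K : equation_family -> Prop =>
                  exists q i, K = family_class r sigma q i) 24.
Proof.
  pose (indices := list_prod (q1 :: q2 :: q3 :: q4 :: nil)
                     (i1 :: i2 :: i3 :: i4 :: i5 :: i6 :: nil)).
  exists (map (fun p => family_class r sigma (fst p) (snd p)) indices); splits.
  - apply Injective_map_NoDup.
    + intros [q i] [q' i'] e.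
      destruct (family_class_injective q q' i i' e); now subst.
    + unfold indices; simpl.
      repeat constructor; simpl; intuition discriminate.
  - reflexivity.
  - intros K; rewrite in_map_iff; split.
    + intros ([q i] & <- & _); now exists q, i.
    + intros (q & i & ->); exists (q, i); split; [reflexivity|].
      apply in_prod; [destruct q | destruct i]; simpl; tauto.
Qed.

End Classes.

Theorem theorem2 (r sigma : R) (hr : r <> 0) (hsigma : sigma <> 0) :
  (forall i : group_index, point_symmetry_group r sigma (G r sigma i)) /\
  (forall (q : solution_index) (i : group_index) (n : Z), admissible n ->
     elementary_solution r sigma whole_plane (Phi r sigma q n) /\
     forall eps : R,
       elementary_solution r sigma (dom (G r sigma i) eps)
         (transformed (G r sigma i) eps (Phi r sigma q n)) /\
       determines (dom (G r sigma i) eps)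
         (transformed (G r sigma i) eps (Phi r sigma q n))
         (fun t S =>
            C_fun r sigma q n (act_t (G r sigma i) eps t S)
                              (act_S (G r sigma i) eps t S)
            / act_C (G r sigma i) eps t S 1)) /\
  (forall (q : solution_index) (i : group_index),
     enumerates (fun m : nat => mapped_family r sigma q i (- 2 * Z.of_nat m)%Z)
                (family_class r sigma q i)) /\
  has_cardinal (fun K : equation_family -> Prop =>
                  exists q i, K = family_class r sigma q i) 24.
Proof.
  splits.
  - apply G_point_symmetry_group; assumption.
  - intros q i n hn; split; [apply Phi_elementary_solution; assumption|].
    intros eps; split.
    + apply transformed_Phi_elementary_solution; assumption.
    + apply transformed_Phi_determines; assumption.
  - apply family_class_enumeration; assumption.
  - apply family_class_cardinal; assumption.
Qed.
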